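(* Let $f : S \to S$ be a $C^{1}$ map of the $2$-sphere $S$ that preserves the latitude foliation and has global degree $2$. Then for every integer $n \geq 1$, the $n$-th iterate $f^{n}$ has at least $2^{n}$ (geometrically distinct) fixed points.
   Context: $S$ is the round $2$-sphere in $\mathbb{R}^3$ of diameter $1$ resting on the $xy$-plane with center $(0,0,1/2)$, with its standard orientation. The height of a point of $S$ is its $z$-coordinate $h\in[0,1]$; the Southpole has height $0$ and the Northpole has height $1$. For $0<h<1$, the latitude $L(h)$ is the circle of points of $S$ of height $h$. A continuous map $f:S\to S$ preserves the latitude foliation if it carries each latitude into a latitude (possibly the same one, and not necessarily homeomorphically) or to one of the poles. The global degree of $f$ is the integer $d$ such that $f_*:H_2(S)\to H_2(S)$ is multiplication by $d$. $f^n$ denotes the $n$-th iterate of $f$. The map $f$ is not assumed to be injective. *)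

(* Defs.v *)
From HB Require Import structures.
From mathcomp Require Import freeg.
From mathcomp Require Import all_boot all_order all_algebra.
From mathcomp Require Import all_classical all_reals all_analysis.

Set Implicit Arguments.
Unset Strict Implicit.
Unset Printing Implicit Defensive.

Import Order.TTheory GRing.Theory Num.Theory.
Import numFieldNormedType.Exports.

Local Open Scope classical_set_scope.
Local Open Scope ring_scope.

(* Singular homology with integer coefficients.  Sets coerce to types carrying
   the subspace topology ([set_type]), so the simplices below are maps defined
   on the standard simplex only and Leibniz equality of simplices is equality
   of maps. *)

Definition simplex (R : realType) (n : nat) : set 'rV[R]_n.+1 :=
  [set t | (forall i, 0 <= t 0 i) /\ \sum_i t 0 i = 1].
Arguments simplex : clear implicits.

Definition insert0 (R : realType) (n : nat) (i : 'I_n.+2) (t : 'rV[R]_n.+1) :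
    'rV[R]_n.+2 :=
  \row_j oapp (t 0) 0 (unlift i j).

Lemma insert0_simplex (R : realType) (n : nat) (i : 'I_n.+2)
  (t : simplex R n) : insert0 i (set_val t) \in simplex R n.+1.
Proof.
have [t_ge0 t_sum] := set_valP t; apply/mem_set; split => [j|].
  by rewrite mxE; case: unliftP => //= k _; exact: t_ge0.
rewrite (bigD1_ord i) //= mxE unlift_none /= add0r -[RHS]t_sum.
by apply: eq_bigr => j _; rewrite mxE liftK.
Qed.

Definition face_fun (R : realType) (n : nat) (i : 'I_n.+2) (t : simplex R n) :
    simplex R n.+1 :=
  SigSub (insert0_simplex i t).

Lemma face_continuous (R : realType) (n : nat) (i : 'I_n.+2) :
  continuous (@face_fun R n i).
Proof.
apply: continuous_comp_initial => t.
have insert0_continuous : continuous (@insert0 R n i).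
  move=> x A [V Vx VA].
  have : nbhs x (fun y => forall k, V 0 (lift i k) (y 0 k)).
    exists (fun a k => [set r | V 0 (lift i k) r]) => [a k|y /= Py k].
      by rewrite ord1; have := Vx 0 (lift i k); rewrite mxE liftK.
    exact: Py.
  apply: filterS => y Py; apply: VA => a j; rewrite !ord1 mxE.
  case: unliftP => [k ->|ji] //=.
  apply: nbhs_singleton.
  by have := Vx 0 j; rewrite mxE ji unlift_none.
apply: (@continuous_comp _ _ _ set_val (@insert0 R n i)).
  exact: initial_continuous.
exact: insert0_continuous.
Qed.

Definition face (R : realType) (n : nat) (i : 'I_n.+2) :
    continuousType (simplex R n) (simplex R n.+1) :=
  mkcts (@face_continuous R n i).

Definition sing_simplex (R : realType) (X : topologicalType) (n : nat) :=
  continuousType (simplex R n) X.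

Definition sing_chain (R : realType) (X : topologicalType) (n : nat) :=
  {freeg (sing_simplex R X n) / int}.

Definition boundary (R : realType) (X : topologicalType) (n : nat)
    (c : sing_chain R X n.+1) : sing_chain R X n :=
  fglift (fun s : sing_simplex R X n.+1 =>
    \sum_(i < n.+2) (-1) ^+ i *:
      (<< (s \o face R i : sing_simplex R X n) >> : sing_chain R X n)) c.

Definition chain_map (R : realType) (X Y : topologicalType)
    (f : continuousType X Y) (n : nat) (c : sing_chain R X n) :
    sing_chain R Y n :=
  fglift (fun s : sing_simplex R X n =>
    << (f \o s : sing_simplex R Y n) >> : sing_chain R Y n) c.

(* The class of [z] in [H_n.+1(X)] is the coset of the cycle [z] modulo the
   boundaries. *)
Definition homologous (R : realType) (X : topologicalType) (n : nat)
    (z z' : sing_chain R X n.+1) :=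
  exists w : sing_chain R X n.+2, z - z' = boundary w.

(* [f_* : H_2(X) -> H_2(X)] is multiplication by [d]. *)
Definition global_degree (R : realType) (X : topologicalType)
    (f : continuousType X X) (d : int) :=
  forall z : sing_chain R X 2, boundary z = 0 ->
    homologous (chain_map f z) (d *: z).

Definition center (R : realType) : 'rV[R]_3 :=
  \row_j [:: 0; 0; 1 / 2]`_j.

(* The Euclidean norm is spelled out: [`|p|] is the sup norm on ['rV_3]. *)
Definition sphere (R : realType) : set 'rV[R]_3 :=
  [set p | \sum_i (p 0 i - center R 0 i) ^+ 2 = (1 / 2) ^+ 2].
Arguments sphere : clear implicits.

Definition height (R : realType) (p : sphere R) : R := set_val p 0 ord_max.

Lemma southpole_sphere (R : realType) : (0 : 'rV[R]_3) \in sphere R.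
Proof.
apply/mem_set; rewrite /sphere /= !big_ord_recr big_ord0 /= !mxE /=.
by rewrite !subr0 !sub0r expr0n /= !add0r sqrrN.
Qed.

Definition southpole (R : realType) : sphere R :=
  SigSub (southpole_sphere R).

Lemma northpole_sphere (R : realType) :
  (\row_j [:: 0; 0; 1]`_j : 'rV[R]_3) \in sphere R.
Proof.
apply/mem_set; rewrite /sphere /= !big_ord_recr big_ord0 /= !mxE /=.
by rewrite !subr0 expr0n /= !add0r {1}(splitr 1) addrK.
Qed.

Definition northpole (R : realType) : sphere R :=
  SigSub (northpole_sphere R).

Definition latitude (R : realType) (h : R) : set (sphere R) :=
  [set p | height p = h].

Definition preserves_latitudes (R : realType) (f : sphere R -> sphere R) :=
  forall h : R, 0 < h < 1 ->
    [\/ exists2 h' : R, 0 < h' < 1 & f @` latitude h `<=` latitude h',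
        f @` latitude h `<=` [set southpole R]
      | f @` latitude h `<=` [set northpole R] ].

(* In finite dimension, continuity of [y |-> 'd F y v] for every [v] is
   continuity of [y |-> 'd F y] for the operator norm. *)
Definition C1_on (R : realType) (V W : normedModType R) (U : set V)
    (F : V -> W) :=
  (forall x, U x -> differentiable F x) /\
  (forall v x, U x -> {for x, continuous (fun y => 'd F y v)}).

(* A map of the sphere is C^1 when it locally extends to C^1 maps of the
   ambient space. *)
Definition C1_sphere (R : realType) (f : sphere R -> sphere R) :=
  forall p : sphere R, exists (U : set 'rV[R]_3) (F : 'rV[R]_3 -> 'rV[R]_3),
    [/\ open U, U (set_val p), C1_on U F &
        forall q : sphere R, U (set_val q) -> F (set_val q) = set_val (f q)].

(* Main.v *)
Require Import Defs.
From mathcomp Require Import freeg.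
From mathcomp Require Import all_boot all_order all_algebra.
From mathcomp Require Import all_classical all_reals all_analysis.
From mathcomp Require Import zify ring lra.

(* Let [g] be the [n]-th iterate of [f], and let [phi] be the map of [0, 1]
   induced by [g] on heights.

   Degree.  A map of a simplex to the sphere lifts to nonzero vectors [(a, b)] of
   C^2 (the Hopf bundle), and comparing the lift of a 2-simplex with chosen lifts
   of its edges gives a singular 2-cocycle.  Evaluated on the image under [g] of
   the cycle that wraps a triangle around the sphere, it is 2 pi times an integer
   [d]; since it is 2 pi on the cycle itself, [d = 2 ^ n].  As [a] does not vanish
   away from the north pole, nor [b] away from the south pole, the angles turned
   by [a] and by [b] along the images of the latitudes, corrected by the holonomy
   of the lift, are 2 pi times integers [NS t] and [NN t], locally constant on
   [phi < 1] and on [0 < phi].  They start at 0, end at [d], and [NN t - NS t] is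
   the degree of [g] on the latitude of height [t].

   Counting.  A circle map of degree [k] has at least [|k - 1|] fixed points.
   Following [phi] from one visit to a pole to the next, one finds at least
   [NS t + 1] fixed points of height at most [t] when [phi t = 0], and at least
   [NN t] when [phi t = 1].  Crossings towards the north need a fixed height away
   from the poles; near a fixed pole this is where C^1 enters: if the degree on
   small latitudes is at least 2, two points of the latitude at a fixed angle have
   the same image, so the derivative at the pole vanishes and the pole attracts. *)

Set Implicit Arguments.
Unset Strict Implicit.
Unset Printing Implicit Defensive.

Import Order.TTheory GRing.Theory Num.Theory.
Import numFieldNormedType.Exports.
Local Open Scope classical_set_scope.
Local Open Scope card_scope.
Local Open Scope ring_scope.

(** * Angles *)

Section Polar.
Variable R : realType.
Implicit Types (x y a b c : R).

(** The number [a] is an argument of the nonzero complex number x + i y. Angles are real numbers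
    here, not classes modulo 2 pi. *)
Definition polar a x y := exists2 r : R, 0 < r & x = r * cos a /\ y = r * sin a.

Lemma polar_ex x y : 0 < x ^+ 2 + y ^+ 2 -> exists a, polar a x y.
Proof.
move=> n_gt0; set r := Num.sqrt (x ^+ 2 + y ^+ 2).
have r_gt0 : 0 < r by rewrite sqrtr_gt0.
have r2 : r ^+ 2 = x ^+ 2 + y ^+ 2 by rewrite sqr_sqrtr // ltW.
have xr : -1 <= x / r <= 1.
  rewrite ler_pdivlMr // ler_pdivrMr // mulN1r mul1r -ler_norml.
  by rewrite -sqrtr_sqr ler_sqrt ?lerDl ?sqr_ge0 // ltW.
have cE : r * cos (acos (x / r)) = x.
  by rewrite acosK ?in_itv //= mulrC divfK ?gt_eqF.
have sE : r * sin (acos (x / r)) = `|y|.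
  rewrite sin_acos // -[X in X * _]gtr0_norm // -sqrtr_sqr -sqrtrM ?sqr_ge0 //.
  rewrite -(sqrtr_sqr y); congr Num.sqrt.
  rewrite mulrBr mulr1 exprMn exprVn mulrCA divff ?mulr1; last first.
    by rewrite expf_neq0 ?gt_eqF.
  by rewrite r2 addrAC subrr add0r.
have [y_ge0|y_lt0] := leP 0 y.
  by exists (acos (x / r)), r => //; rewrite cE sE ger0_norm.
by exists (- acos (x / r)), r => //; rewrite cosN sinN mulrN cE sE ltr0_norm ?opprK.
Qed.

Lemma polar_gt0 a x y : polar a x y -> 0 < x ^+ 2 + y ^+ 2.
Proof.
move=> [r r_gt0 [-> ->]].
by rewrite !exprMn -mulrDr cos2Dsin2 mulr1 exprn_gt0.
Qed.

Lemma polarM a b x y x' y' : polar a x y -> polar b x' y' ->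
  polar (a + b) (x * x' - y * y') (x * y' + y * x').
Proof.
move=> [r r_gt0 [-> ->]] [r' r'_gt0 [-> ->]].
by exists (r * r'); rewrite ?mulr_gt0 // cosD sinD; split; ring.
Qed.

Lemma polarN a x y : polar a x y -> polar (- a) x (- y).
Proof. by move=> [r r_gt0 [-> ->]]; exists r; rewrite // cosN sinN mulrN. Qed.

Lemma polarZ a x y k : 0 < k -> polar a (k * x) (k * y) <-> polar a x y.
Proof.
move=> k_gt0; split => [[r r_gt0 [xE yE]]|[r r_gt0 [-> ->]]]; last first.
  by exists (k * r); rewrite ?mulr_gt0 // !mulrA.
have kn0 : k != 0 by rewrite gt_eqF.
exists (r / k); first by rewrite divr_gt0.
by split; apply: (mulfI kn0); rewrite ?xE ?yE; field.
Qed.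

Lemma polar_atan x y : 0 < x -> polar (atan (y / x)) x y.
Proof.
move=> x_gt0; have c_gt0 : 0 < cos (atan (y / x)).
  by rewrite cos_gt0_pihalf // atan_gtNpi2 atan_ltpi2.
exists (x / cos (atan (y / x))); first by rewrite divr_gt0.
rewrite divfK ?gt_eqF //; split => //.
rewrite -mulrA [_^-1 * _]mulrC -/(tan _) atanK mulrC divfK // gt_eqF //.
Qed.

Lemma cos_eq1 a : cos a = 1 -> exists k : int, a = 2 * pi * k%:~R.
Proof.
move=> ca; pose k := Num.floor (a / (2 * pi)).
have pi2_gt0 : 0 < 2 * pi :> R by rewrite mulr_gt0 // pi_gt0.
exists k; pose b := a - 2 * pi * k%:~R.
have b_itv : 0 <= b < 2 * pi.
  have /andP[l u] := floor_itv (a / (2 * pi)).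
  move: l u; rewrite ler_pdivlMr // ltr_pdivrMr // intrD -/k => l u.
  by rewrite /b; apply/andP; split; lra.
have cosk : forall (m : nat) (c : R), cos (c + 2 * pi * m%:R) = cos c.
  move=> m c; rewrite -(periodicn (@cosD2pi R) m c); congr cos.
  by rewrite -(mulr_natr (pi *+ 2)) -(mulr_natl pi 2).
have cb : cos b = 1.
  rewrite -ca /b; case: (k) => m.
    by rewrite -[RHS](cosk m) -(cosk m (_ - _)) subrK cosk.
  rewrite NegzE mulrNz mulrN opprK; exact: cosk.
apply/eqP; rewrite -subr_eq0 -/b; apply/eqP.
(* By the half-angle formula. As b / 2 lies in [0, pi), where the sine vanishes only at 0, this
   forces b = 0. *)
have sb2 : sin (b / 2) = 0.
  have : cos (b / 2 *+ 2) = 1 by rewrite -mulr_natr divfK.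
  rewrite cos_mulr2n cos2sin2 => h; apply/eqP; rewrite -sqrf_eq0; apply/eqP.
  lra.
apply/eqP/negP => /negP b_neq0; suff : 0 < sin (b / 2) by rewrite sb2 ltxx.
apply: sin_gt0_pi; move: b_itv; rewrite le_eqVlt eq_sym (negPf b_neq0) /= => /andP[? ?].
by apply/andP; split; lra.
Qed.

Lemma polar_uniq a b x y : polar a x y -> polar b x y ->
  exists k : int, a - b = 2 * pi * k%:~R.
Proof.
move=> pa pb; apply: cos_eq1.
have [r r_gt0 [xE yE]] := polarM pa (polarN pb).
have n_gt0 := polar_gt0 pa.
have s0 : sin (a - b) = 0.
  by apply: (mulfI (lt0r_neq0 r_gt0)); rewrite -yE; ring.
have : 0 < cos (a - b).
  rewrite -(pmulr_rgt0 _ r_gt0) -xE; apply: lt_le_trans n_gt0 _.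
  by rewrite le_eqVlt; apply/orP; left; apply/eqP; ring.
have := cos2Dsin2 (a - b); rewrite s0 expr0n addr0 => /eqP.
rewrite sqrf_eq1 => /orP[/eqP ->//|/eqP ->]; lra.
Qed.

Lemma polar2pi a x y (k : int) : polar a x y -> polar (a + 2 * pi * k%:~R) x y.
Proof.
have P (m : nat) c : polar c x y -> polar (c + 2 * pi * m%:R) x y.
  move=> [r r_gt0 [-> ->]]; exists r => //.
  by rewrite mulr_natr mulr_natl (periodicn (@cosD2pi R)) (periodicn (@sinD2pi R)).
case: k => m; first exact: P.
move=> pa; have [b pb] := polar_ex (polar_gt0 pa).
have [j jE] := polar_uniq pa pb.
rewrite NegzE mulrNz; case: pa => r r_gt0 [xE yE]; exists r => //.
have [] : cos (a + 2 * pi * (- m.+1%:~R)) = cos a /\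
    sin (a + 2 * pi * (- m.+1%:~R)) = sin a; last by move=> -> ->.
set c := a + _; have -> : a = c + (pi *+ 2) *+ m.+1.
  by rewrite /c -[_ *+ m.+1]mulr_natl -(mulr_natl pi) /=; ring.
by rewrite (periodicn (@cosD2pi R)) (periodicn (@sinD2pi R)).
Qed.

Lemma continuous_int_const (f : R -> R) : continuous f ->
  (forall s, 0 <= s <= 1 -> exists k : int, f s = k%:~R) -> f 0 = f 1.
Proof.
move=> cf fZ; have [k0 f0] := fZ 0 ltac:(by rewrite lexx ler01).
have [k1 f1] := fZ 1 ltac:(by rewrite lexx ler01).
apply/eqP/negP => /negP neq.
(* The value half a unit above the smaller end would be attained, yet it is not an integer. *)
have hv : Num.min (f 0) (f 1) <= Num.min (f 0) (f 1) + 1/2 <= Num.max (f 0) (f 1).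
  apply/andP; split; first lra.
  rewrite f0 f1; rewrite f0 f1 eqr_int in neq.
  have [lt|gt|/eqP] := ltgtP k0 k1; last by rewrite (negPf neq).
    rewrite minEle maxEle !ler_int (ltW lt).
    have : (k0%:~R + 1 <= k1%:~R :> R) by rewrite -intrD1 ler_int lezD1.
    lra.
  rewrite minEle maxEle !ler_int !(leNgt k0 k1) gt /=.
  have : (k1%:~R + 1 <= k0%:~R :> R) by rewrite -intrD1 ler_int lezD1.
  lra.
have [c + fc] := IVT ler01 (continuous_subspaceT cf) hv.
rewrite in_itv /= => /fZ[k fk].
have [m mE] : exists m : int, Num.min (f 0) (f 1) = m%:~R.
  by rewrite minEle; case: ifP; [exists k0|exists k1].
move: fc; rewrite fk mE => e.
have l1 : (m%:~R < k%:~R :> R) by lra.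
have l2 : (k%:~R < (m + 1)%:~R :> R) by rewrite intrD1; lra.
move: l1 l2; rewrite !ltr_int => l1 l2.
by have := lt_le_trans l2 (etrans (lezD1 m k) l1); rewrite ltxx.
Qed.

End Polar.

(** * Lifting along a contraction *)

Section Contraction.
Variable R : realType.

Definition contracts (T : topologicalType) (H : R -> T -> T) (b : T) :=
  [/\ compact [set: T], continuous (fun p : R * T => H p.1 p.2),
      forall x, H 0 x = b & forall x, H 1 x = x].

(** By compactness of [0, 1] x T, a contraction cut into enough equal steps has consecutive stages
    pointwise [W]-close. A construction over the constant map that survives one small step therefore
    reaches the identity. Angles and Hopf lifts are both obtained this way. *)
Lemma contraction_ind (T : topologicalType) (H : R -> T -> T) (b : T)
    (W : T -> T -> Prop) (Q : (T -> T) -> Prop) :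
  contracts H b -> (forall x, nbhs ((x, x) : T * T) (fun p => W p.1 p.2)) ->
  Q (fun=> b) ->
  (forall g g', continuous g -> continuous g' -> (forall x, W (g x) (g' x)) ->
     Q g -> Q g') -> Q id.
Proof.
move=> [Tc Hc H0 H1] Wn Q0 QS.
have Hs s : continuous (H s).
  move=> x; apply: (@continuous2_cvg _ _ _ _ (nbhs x) _ (fun=> s) id H).
  - exact: (Hc (s, x)).
  - exact: cvg_cst.
  - exact: cvg_id.
have K : compact (`[0 : R, 1] `*` [set: T]).
  by apply: compact_setX => //; exact: segment_compact.
have [] := (compact_near_coveringP _).1 K R (nbhs (0 : R))
  (fun d p => W (H p.1 p.2) (H (p.1 + d) p.2)) _ _.
  move=> [s x] _ /=.
  have c1 : (H p.1.1 p.1.2) @[p --> ((s, x), (0 : R))] --> H s x.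
    apply: (@continuous2_cvg _ _ _ _ _ _ (fun p : R * T * R => p.1.1)
      (fun p => p.1.2) H).
    - exact: (Hc (s, x)).
    - exact: (cvg_comp _ _ cvg_fst cvg_fst).
    - exact: (cvg_comp _ _ cvg_fst cvg_snd).
  have c2 : (H (p.1.1 + p.2) p.1.2) @[p --> ((s, x), (0 : R))] --> H s x.
    apply: (@continuous2_cvg _ _ _ _ _ _ (fun p : R * T * R => p.1.1 + p.2)
      (fun p => p.1.2) H).
    - exact: (Hc (s, x)).
    - rewrite -[s in _ --> s]addr0; apply: cvgD; last exact: cvg_snd.
      exact: (cvg_comp _ _ cvg_fst cvg_fst).
    - exact: (cvg_comp _ _ cvg_fst cvg_snd).
  exact: (cvg_pair c1 c2 (Wn (H s x))).
move=> e /= e_gt0 eP.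
have [N /= N_gt0 Ne] : exists2 N : nat, (0 < N)%N & N%:R^-1 < e.
  exists (Num.bound e^-1).+1 => //.
  rewrite -[e in _ < e]invrK ltf_pV2 ?posrE ?invr_gt0 //.
  by rewrite (lt_trans (archi_boundP _)) ?invr_ge0 ?ltW // ltr_nat.
suff P k : (k <= N)%N -> Q (H (k%:R / N%:R)).
  have := P N (leqnn N); rewrite divff ?pnatr_eq0 -?lt0n //.
  by congr Q; apply/funext.
elim: k => [_|k IH kN].
  by rewrite mul0r (_ : H 0 = fun=> b) //; apply/funext.
apply: (QS (H (k%:R / N%:R))) => //; last exact: IH (ltnW kN).
move=> x; have NR : 0 < N%:R :> R by rewrite ltr0n.
have := eP N%:R^-1; rewrite /= sub0r normrN ger0_norm ?invr_ge0 ?ltW //.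
move=> /(_ Ne (k%:R / N%:R, x)) /=.
rewrite -[X in _ / _ + X]mul1r -mulrDl natr1; apply; split => //=.
rewrite in_itv /= divr_ge0 ?ler0n //= ler_pdivrMr // mul1r ler_nat ltnW //.
Qed.

(** Along the path from [b] to [x] traced by the contraction, [f] is a continuous integer-valued
    function of time. *)
Lemma contraction_int_const (T : topologicalType) (H : R -> T -> T) (b : T)
    (f : T -> R) : contracts H b -> continuous f ->
  (forall x, exists k : int, f x = k%:~R) -> forall x, f x = f b.
Proof.
move=> [_ Hc H0 H1] cf fZ x; rewrite -(H0 x) -[in LHS](H1 x).
apply/esym; apply: (continuous_int_const (f := fun s => f (H s x))) => // s.
apply: (@cvg_comp _ _ _ (fun s => H s x) f); last exact: cf.
apply: (@continuous2_cvg _ _ _ _ (nbhs s) _ id (fun=> x) H).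
- exact: (Hc (s, x)).
- exact: cvg_id.
- exact: cvg_cst.
Qed.

(** At each small step of the contraction the new plane vector makes an acute angle with the old
    one, and this angle, the [atan] of cross over dot product, is added to the lift. *)
Lemma angle_lift (T : topologicalType) (H : R -> T -> T) (b : T) (u v : T -> R) :
  contracts H b -> continuous u -> continuous v ->
  (forall x, 0 < u x ^+ 2 + v x ^+ 2) ->
  exists2 l : T -> R, continuous l & forall x, polar (l x) (u x) (v x).
Proof.
move=> Hb cu cv uv_gt0.
pose dot x y := u x * u y + v x * v y.
pose cross x y := u x * v y - v x * u y.
pose Q g := exists2 l : T -> R, continuous l &
  forall x, polar (l x) (u (g x)) (v (g x)).
apply: (@contraction_ind _ _ _ (fun x y => 0 < dot x y) Q Hb).
- move=> x; have c : dot p.1 p.2 @[p --> (x, x)] --> dot x x.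
    apply: cvgD; apply: cvgM.
    + apply: (@cvg_comp _ _ _ fst u); [exact: cvg_fst|exact: cu].
    + apply: (@cvg_comp _ _ _ snd u); [exact: cvg_snd|exact: cu].
    + apply: (@cvg_comp _ _ _ fst v); [exact: cvg_fst|exact: cv].
    + apply: (@cvg_comp _ _ _ snd v); [exact: cvg_snd|exact: cv].
  by apply: (cvgr_gt _ c); rewrite /dot -!expr2.
- have [a pa] := polar_ex (uv_gt0 b).
  by exists (fun=> a) => //; exact: cst_continuous.
move=> g g' cg cg' gg' [l cl lP].
exists (fun x => l x + atan (cross (g x) (g' x) / dot (g x) (g' x))).
  move=> x; apply: cvgD; first exact: cl.
  apply: (@cvg_comp _ _ _ _ (@atan R)); last exact: continuous_atan.
  have C (h k : T -> R) (h' : T -> T) (k' : T -> T) : continuous h ->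
      continuous k -> continuous h' -> continuous k' ->
      h (h' y) * k (k' y) @[y --> x] --> h (h' x) * k (k' x).
    move=> ch ck ch' ck'; apply: cvgM.
      apply: (@cvg_comp _ _ _ h' h); [exact: ch'|exact: ch].
    apply: (@cvg_comp _ _ _ k' k); [exact: ck'|exact: ck].
  apply: cvgM; first by apply: cvgB; apply: C.
  by apply: cvgV; [rewrite gt_eqF|apply: cvgD; apply: C].
move=> x; have p2 := polar_atan (cross (g x) (g' x)) (gg' x).
have n_gt0 := uv_gt0 (g x).
(* With z and z' the vectors at [g x] and [g' x], dot + i cross is conj(z) z', and z conj(z) z' =
   |z|^2 z'. *)
rewrite -(polarZ _ _ _ n_gt0); have := polarM (lP x) p2.
by rewrite /dot /cross; congr polar; ring.
Qed.

End Contraction.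

(** * Simplices *)

(** The subtype is the image of the compact set [A] under the identity of [A] extended by the
    constant [a], a map continuous on [A]. *)
Lemma compact_setT_set_type (X : topologicalType) (A : set X) :
  compact A -> compact [set: A].
Proof.
move=> Ac; have [[a _]|A0] := pselect (exists a : A, True); last first.
  have -> : [set: A] = set0 by apply/seteqP; split => // a _; case: A0; exists a.
  exact: compact0.
have -> : [set: A] = valL_ a (id : A -> A) @` A.
  apply/seteqP; split => // x _; exists (set_val x); first exact: set_valP.
  by have /(congr1 (fun f => f x)) := valLK a (id : A -> A).
apply: continuous_compact Ac.
apply/(subspace_valL_continuousP' A a).
by move=> x; exact: cvg_id.
Qed.

Section Simplices.
Variable R : realType.

(** The retraction of the line onto [0, 1], in a closed form whose continuity is immediate. It lets
    parameters range over the whole line. *)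
Definition clamp (s : R) := (`|s| - `|s - 1| + 1) / 2.

Lemma clampE s : 0 <= s <= 1 -> clamp s = s.
Proof.
by move=> /andP[? ?]; rewrite /clamp ger0_norm // ler0_norm ?subr_le0 //; lra.
Qed.

Lemma clamp_itv s : 0 <= clamp s <= 1.
Proof.
rewrite /clamp; case: (ler0P s) => ?; case: (ler0P (s - 1)) => ?;
  by apply/andP; split; lra.
Qed.

Lemma clamp_continuous : continuous clamp.
Proof.
move=> s; apply: cvgM; last exact: cvg_cst.
apply: cvgD; last exact: cvg_cst.
apply: cvgB; first by apply: cvg_norm; exact: cvg_id.
by apply: cvg_norm; apply: cvgB; [exact: cvg_id|exact: cvg_cst].
Qed.

(** Straight-line contraction; clamping the time keeps the point in [K] for every real parameter. *)
Lemma star_contracts (V : normedModType R) (K : set V) (b : K) :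
  compact K ->
  (forall s (x : V), 0 <= s <= 1 -> K x ->
     K (set_val b + s *: (x - set_val b))) ->
  exists H : R -> K -> K, contracts H b.
Proof.
move=> Kc Ks.
have HK s (x : K) : set_val b + clamp s *: (set_val x - set_val b) \in K.
  by apply/mem_set/Ks; [exact: clamp_itv|exact: set_valP].
exists (fun s x => SigSub (HK s x)); split.
- exact: compact_setT_set_type.
- apply: continuous_comp_initial => -[s x] /=.
  apply: cvgD; first exact: cvg_cst.
  apply: (@cvgZ _ _ _ _ _ (fun p : R * K => clamp p.1)).
    by apply: (@cvg_comp _ _ _ fst clamp);
      [exact: cvg_fst|exact: clamp_continuous].
  apply: cvgB; last exact: cvg_cst.
  by apply: (@cvg_comp _ _ _ snd set_val); [exact: cvg_snd|exact: initial_continuous].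
- move=> x; apply/val_inj => /=.
  by rewrite clampE ?lexx ?ler01 // scale0r addr0.
- move=> x; apply/val_inj => /=.
  by rewrite clampE ?lexx ?ler01 // scale1r addrC subrK.
Qed.

Lemma sum_coord_continuous n : continuous (fun t : 'rV[R]_n => \sum_i t 0 i).
Proof.
apply: continuous_big => [|i _]; [exact: add_continuous|exact: coord_continuous].
Qed.

Lemma simplex_compact n : compact (simplex R n).
Proof.
have -> : simplex R n = [set t | forall i, t ord0 i \in `[0, 1]] `&`
    (fun t => \sum_i t 0 i) @^-1` [set 1].
  apply/seteqP; split => t /= [t0 t1]; split => // i.
    rewrite in_itv /= t0 -t1 (bigD1 i) //= lerDl sumr_ge0 //.
  by have := t0 i; rewrite in_itv /= => /andP[].
apply: compact_closedI; last first.
  exact: ((continuous_closedP _).1 (@sum_coord_continuous n.+1) _ (@closed_eq _ 1)).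
apply: (@rV_compact _ _ (fun=> `[0 : R, 1]%classic)) => _.
exact: segment_compact.
Qed.

Lemma vertex_subproof n (i : 'I_n.+1) : delta_mx 0 i \in simplex R n.
Proof.
apply/mem_set; split=> [j|]; first by rewrite mxE /= ler0n.
rewrite (bigD1 i) //= mxE !eqxx big1 ?addr0 // => j /negPf ji.
by rewrite mxE ji andbF.
Qed.

Definition vertex n (i : 'I_n.+1) : simplex R n := SigSub (vertex_subproof i).

Lemma face_vertex n (i : 'I_n.+2) (j : 'I_n.+1) :
  face_fun i (vertex j) = vertex (lift i j).
Proof.
apply/val_inj/rowP => k /=; rewrite !mxE /=.
case: unliftP => [l ->|->] /=; first by rewrite mxE (inj_eq lift_inj).
by rewrite (negPf (neq_lift _ _)).
Qed.

Lemma simplex_contracts n :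
  exists H : R -> simplex R n -> simplex R n, contracts H (vertex ord0).
Proof.
apply: star_contracts; first exact: simplex_compact.
move=> s x s01 [x0 x1]; have [b0 b1] := set_valP (vertex (@ord0 n)).
move: b0 b1; set b := set_val _ => b0 b1; split=> [i|].
  rewrite !mxE -[X in X + _]mul1r mulrBr addrCA -mulrBl.
  by case/andP: s01 => ? ?; rewrite addr_ge0 ?mulr_ge0 // subr_ge0.
rewrite (eq_bigr (fun i => (1 - s) * b 0 i + s * x 0 i)) => [|i _].
  by rewrite big_split /= -!mulr_sumr b1 x1 !mulr1 subrK.
by rewrite !mxE; ring.
Qed.

End Simplices.

(** * The Hopf bundle *)

Section Hopf.
Variable R : realType.

Definition crd1 (q : sphere R) : R := set_val q 0 0.
Definition crd2 (q : sphere R) : R := set_val q 0 1.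

Lemma ord3P (i : 'I_3) : [\/ i = 0, i = 1 | i = ord_max].
Proof.
have : [|| i == 0, i == 1 | i == ord_max] by case: i => [[|[|[]]]].
by move=> /or3P[] /eqP; [constructor 1|constructor 2|constructor 3].
Qed.

Lemma sphereE (q : sphere R) :
  crd1 q ^+ 2 + crd2 q ^+ 2 = height q * (1 - height q).
Proof.
have : \sum_i (set_val q 0 i - Defs.center R 0 i) ^+ 2 = (1 / 2) ^+ 2.
  exact: (set_valP q).
rewrite !big_ord_recr big_ord0 /= !mxE /= add0r !subr0.
rewrite /crd1 /crd2 /height.
have -> : widen_ord (leqnSn 2) (widen_ord (leqnSn 1) ord_max) = 0 :> 'I_3 by exact/val_inj.
have -> : widen_ord (leqnSn 2) ord_max = 1 :> 'I_3 by exact/val_inj.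
lra.
Qed.

Lemma height_itv (q : sphere R) : 0 <= height q <= 1.
Proof.
have := sphereE q; have := sqr_ge0 (crd1 q); have := sqr_ge0 (crd2 q).
by move=> ? ? ?; apply/andP; split; nra.
Qed.

Lemma sphere_coord_continuous (i : 'I_3) :
  continuous (fun q : sphere R => set_val q 0 i).
Proof.
move=> q; apply: (@cvg_comp _ _ _ set_val (fun t : 'rV[R]_3 => t 0 i)).
  exact: initial_continuous.
exact: coord_continuous.
Qed.

(** The vector (a1 + i a2, b1 + i b2) of C^2. *)
Record spinor := Spinor { a1 : R; a2 : R; b1 : R; b2 : R }.

Definition spinor_cts (T : topologicalType) (v : T -> spinor) :=
  [/\ continuous (a1 \o v), continuous (a2 \o v), continuous (b1 \o v) &
      continuous (b2 \o v)].

Definition norm2 v := a1 v ^+ 2 + a2 v ^+ 2 + b1 v ^+ 2 + b2 v ^+ 2.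

(* The nonzero vectors [(a, b)] of C^2 in the image of the projector
   [[1 - h, x - iy], [x + iy, h]], that is, in the Hopf fibre over [(x, y, h)]. *)
Definition over (v : spinor) (q : sphere R) :=
  let: Spinor a1 a2 b1 b2 := v in
  [/\ height q * a1 = crd1 q * b1 + crd2 q * b2,
      height q * a2 = crd1 q * b2 - crd2 q * b1,
      crd1 q * a1 - crd2 q * a2 = (1 - height q) * b1,
      crd1 q * a2 + crd2 q * a1 = (1 - height q) * b2 &
      0 < norm2 v].

Lemma over_ex q : exists v, over v q.
Proof.
have sE := sphereE q; have /andP[h0 h1] := height_itv q.
have [h_lt1|h_ge1] := ltP (height q) 1.
  (* The first column of the projector, which vanishes only at the north pole; there (0, 1) is
     used. *)
  exists (Spinor (1 - height q) 0 (crd1 q) (crd2 q)).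
  split; rewrite /norm2 /=; try lra.
have hE : height q = 1 by apply/eqP; rewrite eq_le h1 h_ge1.
have s1 := sqr_ge0 (crd1 q); have s2 := sqr_ge0 (crd2 q).
move: sE; rewrite hE subrr mulr0 => sE.
have /eqP x0 : crd1 q == 0 by rewrite -sqrf_eq0; apply/eqP; lra.
have /eqP y0 : crd2 q == 0 by rewrite -sqrf_eq0; apply/eqP; lra.
exists (Spinor 0 0 1 0); split; rewrite /norm2 /= ?hE ?x0 ?y0; try lra.
Qed.

Definition proj (q : sphere R) (v : spinor) : spinor :=
  let: Spinor a1 a2 b1 b2 := v in
  Spinor ((1 - height q) * a1 + (crd1 q * b1 + crd2 q * b2))
         ((1 - height q) * a2 + (crd1 q * b2 - crd2 q * b1))
         (crd1 q * a1 - crd2 q * a2 + height q * b1)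
         (crd1 q * a2 + crd2 q * a1 + height q * b2).

Definition close (q q' : sphere R) :=
  [/\ `|crd1 q - crd1 q'| < 1 / 4, `|crd2 q - crd2 q'| < 1 / 4 &
      `|height q - height q'| < 1 / 4].

(** [proj q'] is the projector onto the fibre over [q']. The projection of [v] is nonzero because
    its inner product with [v] is positive: over [q] this product is |v|^2, and moving each of the
    three coordinates by less than 1/4 loses at most 3/4 of it. *)
Lemma over_proj v q q' : over v q -> close q q' -> over (proj q' v) q'.
Proof.
case: v => p1 p2 r1 r2 [e1 e2 e3 e4]; rewrite /norm2 /= => n_gt0 [].
rewrite !ltr_norml => /andP[x1 x2] /andP[y1 y2] /andP[h1 h2].
have sE := sphereE q'; set x := crd1 q' in sE x1 x2 *.
set y := crd2 q' in sE y1 y2 *; set h := height q' in sE h1 h2 *.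
set A := p1 ^+ 2 + p2 ^+ 2; set B := r1 ^+ 2 + r2 ^+ 2.
pose P := p1 * r1 + p2 * r2; pose Q := p1 * r2 - p2 * r1.
have hP : - (A + B) <= 2 * P <= A + B.
  have := sqr_ge0 (p1 - r1); have := sqr_ge0 (p2 - r2).
  have := sqr_ge0 (p1 + r1); have := sqr_ge0 (p2 + r2).
  by rewrite /P /A /B => *; apply/andP; split; nra.
have hQ : - (A + B) <= 2 * Q <= A + B.
  have := sqr_ge0 (p1 - r2); have := sqr_ge0 (p2 - r1).
  have := sqr_ge0 (p1 + r2); have := sqr_ge0 (p2 + r1).
  by rewrite /Q /A /B => *; apply/andP; split; nra.
have A0 : 0 <= A by rewrite addr_ge0 ?sqr_ge0.
have B0 : 0 <= B by rewrite addr_ge0 ?sqr_ge0.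
have AB : 0 < A + B by rewrite /A /B addrA.
have dot0 : 0 < (1 - h) * A + h * B + 2 * (x * P + y * Q).
  have e : (1 - height q) * A + height q * B + 2 * (crd1 q * P + crd2 q * Q) = A + B.
    rewrite /A /B /P /Q.
    have f1 := congr1 (fun t => p1 * t) e1; have f2 := congr1 (fun t => p2 * t) e2.
    have f3 := congr1 (fun t => r1 * t) e3; have f4 := congr1 (fun t => r2 * t) e4.
    move: f1 f2 f3 f4 => /=; lra.
  case/andP: hP => ? ?; case/andP: hQ => ? ?.
  have d1 : - (A + B) / 4 <= (height q - h) * A by nra.
  have d2 : - (1/4) * (A + B) <= 2 * ((x - crd1 q) * P) by nra.
  have d3 : - (1/4) * (A + B) <= 2 * ((y - crd2 q) * Q) by nra.
  have d4 : (height q - h) * A + (h - height q) * B >= - (A + B) / 4.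
    have : - (B) / 4 <= (h - height q) * B by nra.
    have : - (A) / 4 <= (height q - h) * A by nra.
    lra.
  lra.
split; rewrite /proj -/x -/y -/h.
- have := congr1 (fun t => t * p1) sE.
  have := congr1 (fun t => t * p2) sE; move=> /=; lra.
- have := congr1 (fun t => t * p1) sE.
  have := congr1 (fun t => t * p2) sE; move=> /=; lra.
- have := congr1 (fun t => t * r1) sE.
  have := congr1 (fun t => t * r2) sE; move=> /=; lra.
- have := congr1 (fun t => t * r1) sE.
  have := congr1 (fun t => t * r2) sE; move=> /=; lra.
rewrite /norm2 /=; set c1 := _ + (_ + _); set c2 := _ + (_ - _).
set c3 := _ - _ + _; set c4 := _ + _ + h * r2.
have dotE : (1 - h) * A + h * B + 2 * (x * P + y * Q) =
    p1 * c1 + p2 * c2 + r1 * c3 + r2 * c4.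
  by rewrite /A /B /P /Q /c1 /c2 /c3 /c4; ring.
rewrite lt_neqAle; apply/andP; split; last first.
  by rewrite !addr_ge0 ?sqr_ge0.
apply/negP => /eqP c0.
have := sqr_ge0 c1; have := sqr_ge0 c2; have := sqr_ge0 c3; have := sqr_ge0 c4.
move=> g4 g3 g2 g1.
have /eqP z1 : c1 == 0 by rewrite -sqrf_eq0; apply/eqP; lra.
have /eqP z2 : c2 == 0 by rewrite -sqrf_eq0; apply/eqP; lra.
have /eqP z3 : c3 == 0 by rewrite -sqrf_eq0; apply/eqP; lra.
have /eqP z4 : c4 == 0 by rewrite -sqrf_eq0; apply/eqP; lra.
by move: dot0; rewrite dotE z1 z2 z3 z4 !mulr0 !addr0 ltxx.
Qed.

(** At each small step of the contraction the vector is projected to the fibre over the next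
    point. *)
Lemma hopf_lift (T : topologicalType) (H : R -> T -> T) (b : T)
    (f : T -> sphere R) : contracts H b -> continuous f ->
  exists2 v : T -> spinor, spinor_cts v & forall x, over (v x) (f x).
Proof.
move=> Hb cf.
have C i : continuous (fun x => set_val (f x) 0 i : R).
  move=> x; apply: (@cvg_comp _ _ _ f (fun q : sphere R => set_val q 0 i)).
    exact: cf.
  exact: sphere_coord_continuous.
pose Q g := exists2 v : T -> spinor, spinor_cts v & forall x, over (v x) (f (g x)).
apply: (@contraction_ind _ _ _ _ (fun x y => close (f x) (f y)) Q Hb).
- move=> x; have N i : nbhs ((x, x) : T * T)
      (fun p => `|set_val (f p.1) 0 i - set_val (f p.2) 0 i| < 1 / 4 :> R).
    have c : (set_val (f p.1) 0 i - set_val (f p.2) 0 i) @[p --> (x, x)] -->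
        (0 : R).
      rewrite -(subrr (set_val (f x) 0 i)); apply: cvgB.
        apply: (@cvg_comp _ _ _ fst (fun x => set_val (f x) 0 i)).
          exact: cvg_fst.
        exact: C.
      apply: (@cvg_comp _ _ _ snd (fun x => set_val (f x) 0 i)).
        exact: cvg_snd.
      exact: C.
    by apply: (cvgr0_norm_lt _ c); rewrite divr_gt0.
  by apply: filterS3 (N 0) (N 1) (N ord_max) => p; split.
- have [v vP] := over_ex (f b).
  by exists (fun=> v) => //; split; exact: cst_continuous.
move=> g g' cg cg' gg' [v [c1 c2 c3 c4] vP].
exists (fun x => proj (f (g' x)) (v x)); last first.
  by move=> x; exact: over_proj (vP x) (gg' x).
have D i : continuous (fun x => set_val (f (g' x)) 0 i : R).
  move=> x; apply: (@cvg_comp _ _ _ g' (fun x => set_val (f x) 0 i)).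
    exact: cg'.
  exact: C.
have E k : (k = a1 \o v \/ k = a2 \o v) \/ (k = b1 \o v \/ k = b2 \o v) ->
    continuous k by case=> -[] ->.
have -> : (fun x => proj (f (g' x)) (v x)) = fun x =>
  let q := f (g' x) in
  Spinor ((1 - height q) * (a1 \o v) x + (crd1 q * (b1 \o v) x + crd2 q * (b2 \o v) x))
         ((1 - height q) * (a2 \o v) x + (crd1 q * (b2 \o v) x - crd2 q * (b1 \o v) x))
         (crd1 q * (a1 \o v) x - crd2 q * (a2 \o v) x + height q * (b1 \o v) x)
         (crd1 q * (a2 \o v) x + crd2 q * (a1 \o v) x + height q * (b2 \o v) x).
  by apply/funext => x; rewrite /= /proj; case: (v x).
split=> x.
- apply: cvgD; last apply: cvgD; apply: cvgM; try exact: D; try by apply: E; tauto.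
  by apply: cvgB; [exact: cvg_cst|exact: D].
- apply: cvgD; last apply: cvgB; apply: cvgM; try exact: D; try by apply: E; tauto.
  by apply: cvgB; [exact: cvg_cst|exact: D].
- apply: cvgD; first apply: cvgB; apply: cvgM; try exact: D; by apply: E; tauto.
- apply: cvgD; first apply: cvgD; apply: cvgM; try exact: D; by apply: E; tauto.
Qed.

End Hopf.

(** * The degree cocycle *)

Section Turn.
Variable R : realType.
Implicit Types (u v w : spinor R).

(** The relation v = r exp(i m) w in C^2: [m] is the phase of [v] relative to [w]. *)
Definition rotated (m : R) v w := exists2 r : R, 0 < r &
  [/\ a1 v = r * (cos m * a1 w - sin m * a2 w),
      a2 v = r * (cos m * a2 w + sin m * a1 w),
      b1 v = r * (cos m * b1 w - sin m * b2 w) &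
      b2 v = r * (cos m * b2 w + sin m * b1 w)].

Lemma rotated0 v : rotated 0 v v.
Proof. by exists 1 => //; rewrite cos0 sin0; split; ring. Qed.

Lemma rotatedD m n u v w : rotated m u v -> rotated n v w -> rotated (m + n) u w.
Proof.
move=> [r r0 [e1 e2 e3 e4]] [s s0 [f1 f2 f3 f4]].
exists (r * s); rewrite ?mulr_gt0 // cosD sinD e1 e2 e3 e4 f1 f2 f3 f4.
by split; ring.
Qed.

Lemma rotated_polar_a m v w t : rotated m v w -> polar t (a1 w) (a2 w) ->
  polar (m + t) (a1 v) (a2 v).
Proof.
move=> [r r0 [-> -> _ _]] pt; apply/polarZ => //.
have pm : polar m (cos m) (sin m) by exists 1; rewrite ?mul1r.
by have := polarM pm pt; congr polar; ring.
Qed.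

Lemma rotated_polar_b m v w t : rotated m v w -> polar t (b1 w) (b2 w) ->
  polar (m + t) (b1 v) (b2 v).
Proof.
move=> [r r0 [_ _ -> ->]] pt; apply/polarZ => //.
have pm : polar m (cos m) (sin m) by exists 1; rewrite ?mul1r.
by have := polarM pm pt; congr polar; ring.
Qed.

Lemma rotated_uniq m n v w : 0 < norm2 w -> rotated m v w -> rotated n v w ->
  exists k : int, m - n = 2 * pi * k%:~R.
Proof.
move=> w0 vm vn; have [a0|a0] := ltP 0 (a1 w ^+ 2 + a2 w ^+ 2).
  have [t pt] := polar_ex a0.
  have [k kE] := polar_uniq (rotated_polar_a vm pt) (rotated_polar_a vn pt).
  by exists k; rewrite -kE; ring.
have [t pt] : exists t, polar t (b1 w) (b2 w).
  by apply: polar_ex; move: w0; rewrite /norm2; lra.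
have [k kE] := polar_uniq (rotated_polar_b vm pt) (rotated_polar_b vn pt).
by exists k; rewrite -kE; ring.
Qed.

(** A Hopf fibre lies in a complex line, so the complex determinant of two of its vectors vanishes;
    the two equations are its real and imaginary parts. *)
Lemma over_det v w q : over v q -> over w q ->
  a1 v * b1 w - a2 v * b2 w = a1 w * b1 v - a2 w * b2 v /\
  a1 v * b2 w + a2 v * b1 w = a1 w * b2 v + a2 w * b1 v.
Proof.
case: v => p1 p2 r1 r2; case: w => s1 s2 t1 t2 [e1 e2 e3 e4 v0] [f1 f2 f3 f4 w0].
split=> /=.
  have := congr1 (fun t => p1 * t) f3; have := congr1 (fun t => p2 * t) f4.
  have := congr1 (fun t => s1 * t) e3; have := congr1 (fun t => s2 * t) e4.
  have := congr1 (fun t => t1 * t) e1; have := congr1 (fun t => t2 * t) e2.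
  have := congr1 (fun t => r1 * t) f1; have := congr1 (fun t => r2 * t) f2.
  move=> /=; lra.
have := congr1 (fun t => p1 * t) f4; have := congr1 (fun t => p2 * t) f3.
have := congr1 (fun t => s1 * t) e4; have := congr1 (fun t => s2 * t) e3.
have := congr1 (fun t => t1 * t) e2; have := congr1 (fun t => t2 * t) e1.
have := congr1 (fun t => r1 * t) f2; have := congr1 (fun t => r2 * t) f1.
move=> /=; lra.
Qed.

Lemma over_norm2_gt0 v q : over v q -> 0 < norm2 v.
Proof. by case: v => ? ? ? ? []. Qed.

(** Real and imaginary parts of the Hermitian product of [v] with [w]. Inside one fibre its argument
    is the phase of [v] relative to [w]. *)
Definition herm1 v w := a1 v * a1 w + a2 v * a2 w + (b1 v * b1 w + b2 v * b2 w).
Definition herm2 v w := a2 v * a1 w - a1 v * a2 w + (b2 v * b1 w - b1 v * b2 w).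

(** Lagrange's identity: |v|^2 |w|^2 exceeds the squared modulus of the Hermitian product by that of
    the determinant, which is zero in a fibre. *)
Lemma herm_gt0 v w q : over v q -> over w q ->
  0 < herm1 v w ^+ 2 + herm2 v w ^+ 2.
Proof.
move=> vq wq; have [g1 g2] := over_det vq wq.
have : 0 < norm2 v * norm2 w.
  by rewrite mulr_gt0 ?(over_norm2_gt0 vq) ?(over_norm2_gt0 wq).
congr (_ < _); apply/eqP; rewrite -subr_eq0; apply/eqP.
transitivity ((a1 v * b1 w - a2 v * b2 w - (a1 w * b1 v - a2 w * b2 v)) ^+ 2 +
   (a1 v * b2 w + a2 v * b1 w - (a1 w * b2 v + a2 w * b1 v)) ^+ 2).
  by rewrite /norm2 /herm1 /herm2; ring.
by rewrite g1 g2 !subrr expr0n addr0.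
Qed.

Lemma rotated_over v w q t : over v q -> over w q ->
  polar t (herm1 v w) (herm2 v w) -> rotated t v w.
Proof.
move=> vq wq [r r_gt0 [x y]]; have [g1 g2] := over_det vq wq.
have N_gt0 := over_norm2_gt0 wq; have N0 : norm2 w != 0 by rewrite gt_eqF.
exists (r / norm2 w); first by rewrite divr_gt0.
have S c1 c2 z : norm2 w * z = herm1 v w * c1 + herm2 v w * c2 ->
    z = r / norm2 w * (cos t * c1 + sin t * c2).
  by rewrite x y => h; apply: (mulfI N0); rewrite h; field.
split; rewrite -?mulrN; apply: S; rewrite /norm2 /herm1 /herm2.
- have := congr1 (fun t => b1 w * t) g1; have := congr1 (fun t => b2 w * t) g2.
  move=> /=; lra.
- have := congr1 (fun t => b1 w * t) g2; have := congr1 (fun t => b2 w * t) g1.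
  move=> /=; lra.
- have := congr1 (fun t => a1 w * t) g1; have := congr1 (fun t => a2 w * t) g2.
  move=> /=; lra.
- have := congr1 (fun t => a1 w * t) g2; have := congr1 (fun t => a2 w * t) g1.
  move=> /=; lra.
Qed.

Definition angle_cts (T : topologicalType) (l : T -> R) (v w : T -> spinor R) :=
  continuous l /\ forall x, rotated (l x) (v x) (w x).

Lemma ratio_lift (T : topologicalType) (H : R -> T -> T) (b : T)
    (f : T -> sphere R) (v w : T -> spinor R) :
  contracts H b -> spinor_cts v -> spinor_cts w ->
  (forall x, over (v x) (f x)) -> (forall x, over (w x) (f x)) ->
  exists l, angle_cts l v w.
Proof.
move=> Hb [v1 v2 v3 v4] [w1 w2 w3 w4] vf wf.
have [||l cl lP] := angle_lift Hb _ _ (fun x => herm_gt0 (vf x) (wf x)).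
- move=> x; apply: cvgD; apply: cvgD; apply: cvgM;
  [exact: v1|exact: w1|exact: v2|exact: w2|exact: v3|exact: w3|exact: v4|exact: w4].
- move=> x; apply: cvgD; apply: cvgB; apply: cvgM;
  [exact: v2|exact: w1|exact: v1|exact: w2|exact: v4|exact: w3|exact: v3|exact: w4].
by exists l; split=> // x; apply: rotated_over (lP x).
Qed.

Lemma angle_ctsD (T : topologicalType) l m (u v w : T -> spinor R) :
  angle_cts l u v -> angle_cts m v w -> angle_cts (fun x => l x + m x) u w.
Proof.
move=> [cl lP] [cm mP]; split=> x; last exact: rotatedD (lP x) (mP x).
by apply: cvgD; [exact: cl|exact: cm].
Qed.

Lemma angle_cts_comp (T T' : topologicalType) (g : T' -> T) l
    (v w : T -> spinor R) : continuous g ->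
  angle_cts l v w -> angle_cts (l \o g) (v \o g) (w \o g).
Proof.
move=> cg [cl lP]; split=> x; last exact: lP.
by apply: (@cvg_comp _ _ _ g l); [exact: cg|exact: cl].
Qed.

Lemma angle_cts_uniq (T : topologicalType) (H : R -> T -> T) (b : T) l m
    (v w : T -> spinor R) : contracts H b -> (forall x, 0 < norm2 (w x)) ->
  angle_cts l v w -> angle_cts m v w -> forall x, l x - m x = l b - m b.
Proof.
move=> Hb w0 [cl lP] [cm mP] x.
have pi2 : 2 * pi != 0 :> R by rewrite mulf_neq0 ?gt_eqF ?pi_gt0.
suff /(congr1 ( *%R^~ (2 * pi))) : (l x - m x) / (2 * pi) = (l b - m b) / (2 * pi).
  by rewrite /= !divfK.
apply: (contraction_int_const (f := fun x => (l x - m x) / (2 * pi)) Hb) => y.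
  apply: cvgM; last exact: cvg_cst.
  by apply: cvgB; [exact: cl|exact: cm].
have [k ->] := rotated_uniq (w0 y) (lP y) (mP y).
by exists k; rewrite mulrC mulKf.
Qed.

Local Notation D n := (simplex R n).

(** The change of phase of [v] relative to [w] from the first to the last vertex. For nonzero [w]
    two continuous phases differ by a constant, so any of them gives this value; the default 0
    serves only when there is none. *)
Definition turn (v w : D 1 -> spinor R) : R :=
  let l := xget (fun=> 0) [set l | angle_cts l v w] in
  l (vertex R ord_max) - l (vertex R ord0).

Lemma turnE l (v w : D 1 -> spinor R) : (forall x, 0 < norm2 (w x)) -> angle_cts l v w ->
  turn v w = l (vertex R ord_max) - l (vertex R ord0).
Proof.
move=> w0 lP; rewrite /turn; case: xgetP => [m _ mP|/(_ l)]; last by [].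
have [H Hb] := simplex_contracts R 1.
have := angle_cts_uniq Hb w0 mP lP (vertex R ord_max); lra.
Qed.

End Turn.

(** * The 2-cocycle on singular simplices *)

Section Cocycle.
Variable R : realType.
Local Notation D n := (simplex R n).

Lemma insert0E n (i : 'I_n.+2) (t : 'rV[R]_n.+1) k :
  insert0 i t 0 k = if k == i then 0 else t 0 (inord (unbump i k)).
Proof.
rewrite mxE; case: unliftP => [j ->|->] /=; last by rewrite eqxx.
rewrite eq_sym (negPf (neq_lift _ _)); congr (t 0 _).
by apply/val_inj; rewrite /= bumpK inordK.
Qed.

Lemma face_face n (i : 'I_n.+3) (j : 'I_n.+2) (i' : 'I_n.+2) (j' : 'I_n.+3)
    (t : D n) : (j <= i')%N -> i = i'.+1 :> nat -> j' = j :> nat ->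
  face_fun i (face_fun j t) = face_fun j' (face_fun i' t).
Proof.
move=> ji iE jE; apply/val_inj/rowP => k /=; rewrite [LHS]insert0E [RHS]insert0E.
have kn := ltn_ord k; have in' := ltn_ord i'; have jn := ltn_ord j.
rewrite !insert0E -!val_eqE /= iE jE.
have [kj|kj] := eqVneq (k : nat) j.
  rewrite kj; case: ifPn => // _.
  by rewrite inordK /unbump ?ltnNge ?kj; [case: ifPn => // | ]; lia.
have [ki|ki] := eqVneq (k : nat) i'.+1.
  by rewrite inordK /unbump ki; [case: ifPn => // |]; lia.
rewrite !inordK; try by rewrite /unbump; lia.
rewrite (_ : (unbump i'.+1 k == j) = false); last by rewrite /unbump; lia.
rewrite (_ : (unbump j k == i') = false); last by rewrite /unbump; lia.
by congr (set_val t 0 (inord _)); rewrite /unbump; lia.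
Qed.

(** The choice depends on the map [f] alone, so simplices that share an edge use the same lift of
    it; the cocycle identity rests on this. The zero vector is the default for maps without a
    lift. *)
Definition lift_of n (f : D n -> sphere R) : D n -> spinor R :=
  if pselect (exists v, spinor_cts v /\ forall x, over (v x) (f x)) is left h
  then projT1 (cid h) else fun=> Spinor 0 0 0 0.

Lemma lift_ofP n (f : D n -> sphere R) : continuous f ->
  spinor_cts (lift_of f) /\ forall x, over (lift_of f x) (f x).
Proof.
move=> cf; rewrite /lift_of; case: pselect => [h|[]]; first exact: projT2 (cid h).
have [H Hb] := simplex_contracts R n.
by have [v cv vP] := hopf_lift Hb cf; exists v.
Qed.

Lemma spinor_cts_comp (T T' : topologicalType) (g : T' -> T) (v : T -> spinor R) :
  continuous g -> spinor_cts v -> spinor_cts (v \o g).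
Proof.
move=> cg [c1 c2 c3 c4]; split=> x.
- by apply: (@cvg_comp _ _ _ g (@a1 R \o v)); [exact: cg|exact: c1].
- by apply: (@cvg_comp _ _ _ g (@a2 R \o v)); [exact: cg|exact: c2].
- by apply: (@cvg_comp _ _ _ g (@b1 R \o v)); [exact: cg|exact: c3].
- by apply: (@cvg_comp _ _ _ g (@b2 R \o v)); [exact: cg|exact: c4].
Qed.

Definition edge_turn (v : D 1 -> spinor R) (e : D 1 -> sphere R) :=
  turn v (lift_of e).

(** Alternating sum, over the faces, of the phase of [v] relative to the chosen edge lifts. It need
    not be a multiple of 2 pi, since the lifts chosen on adjacent edges may disagree at the common
    vertex. *)
Definition winding (f : D 2 -> sphere R) (v : D 2 -> spinor R) : R :=
  edge_turn (v \o face_fun 0) (f \o face_fun 0)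
  - edge_turn (v \o face_fun 1) (f \o face_fun 1)
  + edge_turn (v \o face_fun ord_max) (f \o face_fun ord_max).

Lemma edge_turnD (e : D 1 -> sphere R) (v w : D 1 -> spinor R) l :
  continuous e -> spinor_cts w -> (forall x, over (w x) (e x)) ->
  angle_cts l v w ->
  edge_turn v e = l (vertex R ord_max) - l (vertex R ord0) + edge_turn w e.
Proof.
move=> ce cw wP lP; have [ct tP] := lift_ofP ce.
have [H Hb] := simplex_contracts R 1.
have [m mP] := ratio_lift Hb cw ct wP tP.
have t0 x := over_norm2_gt0 (tP x).
by rewrite /edge_turn (turnE t0 mP) (turnE t0 (angle_ctsD lP mP)); ring.
Qed.

(** Passing from [w] to [v] adds to each edge the difference of the values of the phase [l] at its
    two ends; around the triangle these cancel. *)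
Lemma winding_indep (f : D 2 -> sphere R) v w : continuous f ->
  spinor_cts v -> (forall x, over (v x) (f x)) ->
  spinor_cts w -> (forall x, over (w x) (f x)) ->
  winding f v = winding f w.
Proof.
move=> cf cv vP cw wP; have [H Hb] := simplex_contracts R 2.
have [l lP] := ratio_lift Hb cv cw vP wP.
have E i : edge_turn (v \o face_fun i) (f \o face_fun i) =
    l (vertex R (lift i ord_max)) - l (vertex R (lift i ord0)) +
    edge_turn (w \o face_fun i) (f \o face_fun i).
  have cF := @face_continuous R 1 i.
  rewrite (@edge_turnD _ _ (w \o face_fun i) (l \o face_fun i)).
  - by rewrite /= !face_vertex.
  - by move=> x; apply: (@cvg_comp _ _ _ (face_fun i) f); [exact: cF|exact: cf].
  - exact: spinor_cts_comp.
  - by move=> x; exact: wP.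
  - exact: angle_cts_comp.
rewrite /winding !E.
rewrite (_ : lift 0 ord_max = ord_max :> 'I_3); last exact/val_inj.
rewrite (_ : lift 0 ord0 = 1 :> 'I_3); last exact/val_inj.
rewrite (_ : lift 1 ord_max = ord_max :> 'I_3); last exact/val_inj.
rewrite (_ : lift 1 ord0 = ord0 :> 'I_3); last exact/val_inj.
rewrite (_ : lift ord_max ord_max = 1 :> 'I_3); last exact/val_inj.
rewrite (_ : lift ord_max ord0 = ord0 :> 'I_3); last exact/val_inj.
ring.
Qed.

Definition cochain (f : D 2 -> sphere R) : R := winding f (lift_of f).

Lemma cochainE (f : D 2 -> sphere R) v : continuous f ->
  spinor_cts v -> (forall x, over (v x) (f x)) -> cochain f = winding f v.
Proof.
move=> cf cv vP; have [cl lP] := lift_ofP cf.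
exact: winding_indep cf cl lP cv vP.
Qed.

(** All four faces are lifted by restricting a single lift of the 3-simplex; each of the six edges
    then occurs twice, with opposite signs. *)
Lemma cochain_boundary (f : D 3 -> sphere R) : continuous f ->
  cochain (f \o face_fun 0) - cochain (f \o face_fun 1)
  + cochain (f \o face_fun (inord 2)) - cochain (f \o face_fun ord_max) = 0.
Proof.
move=> cf; have [cv vP] := lift_ofP cf; set v := lift_of f in cv vP.
have E i : cochain (f \o face_fun i) = winding (f \o face_fun i) (v \o face_fun i).
  have cF := @face_continuous R 2 i.
  apply: cochainE.
  - by move=> x; apply: (@cvg_comp _ _ _ (face_fun i) f); [exact: cF|exact: cf].
  - exact: spinor_cts_comp.
  - by move=> x; exact: vP.
rewrite !E /winding.
have FF (i : 'I_4) (j i' : 'I_3) (j' : 'I_4) : (j <= i')%N -> i = i'.+1 :> nat ->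
    j' = j :> nat -> @face_fun R 2 i \o face_fun j = face_fun j' \o face_fun i'.
  by move=> h1 h2 h3; apply/funext => t; exact: face_face.
pose K g := edge_turn (v \o g) (f \o g).
have FK i j : edge_turn ((v \o face_fun i) \o face_fun j)
    ((f \o face_fun i) \o face_fun j) = K (@face_fun R 2 i \o face_fun j) by [].
rewrite !FK.
rewrite (FF 1 0 0 0) // (FF (inord 2) 0 1 0) ?inordK //.
rewrite (FF (inord 2) 1 1 1) ?inordK // (FF ord_max 0 ord_max 0) //.
rewrite (FF ord_max 1 ord_max 1) // (FF ord_max ord_max ord_max (inord 2)) ?inordK //.
ring.
Qed.

End Cocycle.

(** * Linear extension to free abelian groups *)

Section FreeLift.
Variables (K : choiceType) (M : lmodType int).

Lemma fgliftB (f : K -> M) (z w : {freeg K / int}) :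
  fglift f (z - w) = fglift f z - fglift f w.
Proof. exact: lift_is_additive. Qed.

Lemma fglift0 (f : K -> M) : fglift f (0 : {freeg K / int}) = 0.
Proof. by rewrite -(subrr 0) fgliftB subrr. Qed.

Lemma fgliftN (f : K -> M) (z : {freeg K / int}) : fglift f (- z) = - fglift f z.
Proof. by rewrite -sub0r fgliftB fglift0 sub0r. Qed.

Lemma fgliftD (f : K -> M) (z w : {freeg K / int}) :
  fglift f (z + w) = fglift f z + fglift f w.
Proof.
by rewrite -[w in LHS]opprK fgliftB fgliftN opprK.
Qed.

Lemma fgliftZ (f : K -> M) k (z : {freeg K / int}) :
  fglift f (k *: z) = k *: fglift f z.
Proof.
have Mn n : fglift f (z *+ n) = fglift f z *+ n.
  by elim: n => [|n IH]; rewrite ?mulr0n ?fglift0 // !mulrS fgliftD IH.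
have Zint (V : lmodType int) (v : V) (n : nat) : n%:Z *: v = v *+ n.
  by rewrite -scaler_nat natz.
case: k => n; first by rewrite !Zint.
by rewrite NegzE !scaleNr fgliftN !Zint Mn.
Qed.

Lemma fglift_sum (f : K -> M) I (r : seq I) (F : I -> {freeg K / int}) :
  fglift f (\sum_(i <- r) F i) = \sum_(i <- r) fglift f (F i).
Proof.
by elim/big_ind2: _ => [|u v w x <- <-|//]; [exact: fglift0|rewrite fgliftD].
Qed.

Lemma fgliftE (f : K -> M) (z : {freeg K / int}) :
  fglift f z = \sum_(x <- dom z) coeff x z *: f x.
Proof.
by rewrite -[in LHS](freeg_sumE z) fglift_sum; apply: eq_bigr => x _; exact: liftU.
Qed.

Lemma fglift1 (f : K -> M) x : fglift f (<< x >> : {freeg K / int}) = f x.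
Proof. by rewrite liftU scale1r. Qed.

End FreeLift.

Lemma fglift_comp (K L : choiceType) (M : lmodType int) (f : L -> M)
    (g : K -> {freeg L / int}) (z : {freeg K / int}) :
  fglift f (fglift g z) = fglift (fun x => fglift f (g x)) z.
Proof.
rewrite (fgliftE g) fglift_sum fgliftE.
by apply: eq_bigr => x _; rewrite fgliftZ.
Qed.

Lemma eq_fglift (K : choiceType) (M : lmodType int) (f g : K -> M)
    (z : {freeg K / int}) : f =1 g -> fglift f z = fglift g z.
Proof. by move=> fg; rewrite !fgliftE; apply: eq_bigr => x _; rewrite fg. Qed.

(** * Evaluation of the cocycle on chains *)

Section Chains.
Variable R : realType.

Lemma chain_map_comp (X Y Z : topologicalType) (g : continuousType Y Z)
    (f : continuousType X Y) (h : continuousType X Z) n (c : sing_chain R X n) :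
  h =1 g \o f -> chain_map g (chain_map f c) = chain_map h c.
Proof.
move=> hE; rewrite /chain_map fglift_comp; apply: eq_fglift => s.
rewrite fglift1; congr (<< _ >>); apply/continuousEP => x /=.
by rewrite hE.
Qed.

Lemma boundary_chain_map (X Y : topologicalType) (f : continuousType X Y) n
    (c : sing_chain R X n.+1) :
  Defs.boundary (chain_map f c) = chain_map f (Defs.boundary c).
Proof.
rewrite /Defs.boundary /chain_map !fglift_comp; apply: eq_fglift => s.
rewrite fglift1 fglift_sum; apply: eq_bigr => i _.
rewrite fgliftZ fglift1; congr (_ *: << _ >>).
exact/continuousEP.
Qed.

(** The pairing of the cocycle with 2-chains. The reals are taken as a module over the integers, as
    [fglift] requires. *)
Definition class : sing_chain R (sphere R) 2 -> zmodule R :=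
  fglift (fun s : sing_simplex R (sphere R) 2 => cochain s : zmodule R).

Lemma classZ d z : class (d *: z) = d%:~R * class z :> R.
Proof. by rewrite /class fgliftZ mulrzl. Qed.

Lemma classB z w : class (z - w) = class z - class w.
Proof. exact: fgliftB. Qed.

Lemma class_boundary w : class (Defs.boundary w) = 0.
Proof.
rewrite /class /Defs.boundary fglift_comp.
rewrite (@eq_fglift _ _ _ (fun=> 0) w); last first.
  move=> s; rewrite fglift_sum !big_ord_recl big_ord0 /= !fgliftZ !fglift1.
  rewrite -[RHS](cochain_boundary (@cts_fun _ _ s)) /=.
  have i2 : lift ord0 (lift ord0 ord0) = inord 2 :> 'I_4.
    by apply/val_inj; rewrite /= inordK.
  rewrite !scale1r addr0 i2 [bump 0 0]/= expr1 scaleN1r.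
  rewrite [bump 0 (bump _ _)]/= -signr_odd [odd _]/= expr1 scaleN1r !addrA.
  rewrite (_ : lift ord0 ord0 = 1 :> 'I_4); last exact/val_inj.
  by rewrite (_ : lift ord0 (lift ord0 (lift ord0 ord0)) = ord_max :> 'I_4) //;
    exact/val_inj.
by rewrite fgliftE big1 // => x _; rewrite scaler0.
Qed.

Lemma class_degree (f : continuousType (sphere R) (sphere R)) d z :
  global_degree R f d -> Defs.boundary z = 0 ->
  class (chain_map f z) = d%:~R * class z :> R.
Proof.
move=> fd z0; have [w wE] := fd z z0.
by rewrite -classZ -[LHS](subrK (class (d *: z))) -classB wE class_boundary add0r.
Qed.

(** The image of [z] under an iterate is again a cycle, so each further application of [f]
    multiplies the class by [d]. *)
Lemma class_iter (f g : continuousType (sphere R) (sphere R)) d n z :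
  global_degree R f d -> Defs.boundary z = 0 -> g =1 iter n f ->
  class (chain_map g z) = d%:~R ^+ n * class z :> R.
Proof.
move=> fd z0; elim: n g => [|n IH] g gE.
  rewrite expr0 mul1r; congr class; rewrite /chain_map -[RHS]freeg_sumE fgliftE.
  apply: eq_bigr => s _; rewrite (_ : g \o s = s :> sing_simplex R _ 2); last first.
    by apply/continuousEP => x; rewrite /= gE.
  by apply/eqP/freeg_eqP => x; rewrite coeffZ !coeffU mul1r.
have ch : continuous (iter n f).
  elim: n {IH gE} => [|n IH] x; first exact: cvg_id.
  by apply: (@cvg_comp _ _ _ (iter n f) f); [exact: IH|exact: cts_fun].
have gE' : g =1 f \o mkcts ch by move=> x; rewrite gE.
rewrite -(chain_map_comp z gE') (class_degree fd).
  by rewrite (IH (mkcts ch)) // exprS mulrA.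
by rewrite boundary_chain_map z0 /chain_map fglift0.
Qed.

End Chains.

(** * Wrapping a triangle around the sphere *)

Section Continuity.
Variables (R : realType) (T : topologicalType).
Implicit Types f g : T -> R.

Lemma cts_cst (U : topologicalType) (a : U) : continuous (fun _ : T => a).
Proof. by move=> x; exact: cvg_cst. Qed.

Lemma cts_comp (U V : topologicalType) (g : T -> U) (f : U -> V) :
  continuous g -> continuous f -> continuous (fun x => f (g x)).
Proof. by move=> cg cf x; apply: (@cvg_comp _ _ _ g f); [exact: cg|exact: cf]. Qed.

Lemma eq_cts (U : topologicalType) (f g : T -> U) :
  f =1 g -> continuous g -> continuous f.
Proof. by move=> /funext ->. Qed.

Lemma cts_pair (U V : topologicalType) (f : T -> U) (g : T -> V) :
  continuous f -> continuous g -> continuous (fun x => (f x, g x)).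
Proof. by move=> cf cg x; exact: (cvg_pair (cf x) (cg x)). Qed.

Lemma ctsD f g : continuous f -> continuous g -> continuous (fun x => f x + g x).
Proof. by move=> cf cg x; apply: cvgD; [exact: cf|exact: cg]. Qed.

Lemma ctsB f g : continuous f -> continuous g -> continuous (fun x => f x - g x).
Proof. by move=> cf cg x; apply: cvgB; [exact: cf|exact: cg]. Qed.

Lemma ctsM f g : continuous f -> continuous g -> continuous (fun x => f x * g x).
Proof. by move=> cf cg x; apply: cvgM; [exact: cf|exact: cg]. Qed.

(** Polar coordinates stay continuous where the angle is undefined: at a zero of [d] the radius [r]
    vanishes while [f] is bounded. *)
Lemma cts_polar (r s d : T -> R) (f : R -> R) : (forall x, 0 <= r x) ->
  continuous r -> continuous s -> continuous d -> (forall x, d x = 0 -> r x = 0) ->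
  continuous f -> (forall y, `|f y| <= 1) ->
  continuous (fun x => r x * f (2 * pi * (s x / d x))).
Proof.
move=> r0 cr cs cd d0 cf f1 x; have [s0|s0] := eqVneq (d x) 0.
  have rx : r x = 0 by exact: d0.
  rewrite /continuous_at rx mul0r.
  apply: (@squeeze_cvgr _ _ _ _ (fun x => - r x) r).
  - apply: nearW => y; rewrite -ler_norml normrM ger0_norm //.
    by rewrite ler_piMr.
  - by rewrite -oppr0 -rx; apply: cvgN; exact: cr.
  - by rewrite -rx; exact: cr.
apply: cvgM; first exact: cr.
apply: (@cvg_comp _ _ _ _ f); last exact: cf.
apply: cvgM; first exact: cvg_cst.
by apply: cvgM; [exact: cs|apply: cvgV => //; exact: cd].
Qed.

End Continuity.

Section Parametrization.
Variable R : realType.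
Local Notation D n := (simplex R n).

Lemma rV_continuous (T : topologicalType) n (f : T -> 'rV[R]_n) :
  (forall i, continuous (fun x => f x 0 i)) -> continuous f.
Proof.
move=> cf x A [V Vx VA].
have : nbhs x (fun y => forall i, V 0 i (f y 0 i)).
  by apply: filter_forall => i; apply: (cf i x); exact: Vx.
by apply: filterS => y Py; apply: VA => i j; rewrite ord1.
Qed.

(** The radius of the latitude of height [t], since x^2 + y^2 = h (1 - h) on the sphere. *)
Definition radius (t : R) := Num.sqrt (clamp t * (1 - clamp t)).

Lemma radius2 t : radius t ^+ 2 = clamp t * (1 - clamp t).
Proof.
rewrite sqr_sqrtr //; have /andP[? ?] := clamp_itv t.
by rewrite mulr_ge0 // subr_ge0.
Qed.

Lemma radius_ge0 t : 0 <= radius t.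
Proof. exact: sqrtr_ge0. Qed.

Lemma radius0 : radius 0 = 0.
Proof. by rewrite /radius clampE ?lexx ?ler01 // mul0r sqrtr0. Qed.

Lemma radius1 : radius 1 = 0.
Proof. by rewrite /radius clampE ?lexx ?ler01 // subrr mulr0 sqrtr0. Qed.

Lemma radius_gt0 t : 0 < t < 1 -> 0 < radius t.
Proof.
move=> /andP[t0 t1]; rewrite /radius clampE ?ltW // sqrtr_gt0.
by rewrite mulr_gt0 // subr_gt0.
Qed.

Lemma radius_continuous : continuous radius.
Proof.
move=> t; apply: (@cvg_comp _ _ _ _ Num.sqrt); last exact: sqrt_continuous.
apply: cvgM; first exact: clamp_continuous.
by apply: cvgB; [exact: cvg_cst|exact: clamp_continuous].
Qed.

(** Longitude [th] is measured in full turns. Clamping the height puts the point on the sphere for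
    every real [t]. *)
Definition sph_vec (th t : R) : 'rV[R]_3 :=
  \row_i [:: radius t * cos (2 * pi * th); radius t * sin (2 * pi * th); clamp t]`_i.

Lemma sph_subproof th t : sph_vec th t \in sphere R.
Proof.
apply/mem_set; rewrite /sphere /= !big_ord_recr big_ord0 /= !mxE /= add0r !subr0.
have := radius2 t; have := cos2Dsin2 (2 * pi * th); rewrite !exprMn => /(congr1 ( *%R (radius t ^+ 2))).
rewrite mulr1 mulrDr => -> ->; lra.
Qed.

Definition sph th t : sphere R := SigSub (sph_subproof th t).

Lemma crd1_sph th t : crd1 (sph th t) = radius t * cos (2 * pi * th).
Proof. by rewrite /crd1 /= mxE. Qed.
Lemma crd2_sph th t : crd2 (sph th t) = radius t * sin (2 * pi * th).
Proof. by rewrite /crd2 /= mxE. Qed.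
Lemma height_sph th t : height (sph th t) = clamp t.
Proof. by rewrite /height /= mxE. Qed.

Lemma sphere_eq (p q : sphere R) : crd1 p = crd1 q -> crd2 p = crd2 q ->
  height p = height q -> p = q.
Proof.
move=> e1 e2 e3; apply/val_inj/rowP => i.
by case: (ord3P i) => ->.
Qed.

Lemma sph_radius0 th th' t : radius t = 0 -> sph th t = sph th' t.
Proof.
by move=> r0; apply: sphere_eq;
  rewrite ?crd1_sph ?crd2_sph ?height_sph // r0 !mul0r.
Qed.

Lemma sph01 t : sph 1 t = sph 0 t.
Proof.
apply: sphere_eq; rewrite ?crd1_sph ?crd2_sph ?height_sph //;
  by rewrite mulr1 mulr0 mulr_natl ?cos2pi ?cos0 ?sin2pi ?sin0.
Qed.

(** Vertex 0 goes to the south pole, the opposite edge to the north pole, and the two other edges to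
    the meridian of longitude 0. The quotient 0 / 0 at vertex 0 is harmless, as the radius vanishes
    there. *)
Definition wrap (x : D 2) : sphere R :=
  sph (set_val x 0 ord_max / (set_val x 0 1 + set_val x 0 ord_max))
      (1 - set_val x 0 0).

Lemma simplex_coord_continuous n (i : 'I_n.+1) :
  continuous (fun x : D n => set_val x 0 i).
Proof.
move=> q; apply: (@cvg_comp _ _ _ set_val (fun t : 'rV[R]_n.+1 => t 0 i)).
  exact: initial_continuous.
exact: coord_continuous.
Qed.

Lemma simplex2_sum (x : D 2) :
  set_val x 0 1 + set_val x 0 ord_max = 1 - set_val x 0 0.
Proof.
have [_] := set_valP x; rewrite !big_ord_recr big_ord0 /= add0r.
have -> : widen_ord (leqnSn 2) (widen_ord (leqnSn 1) ord_max) = 0 :> 'I_3 by exact/val_inj.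
have -> : widen_ord (leqnSn 2) ord_max = 1 :> 'I_3 by exact/val_inj.
lra.
Qed.

Lemma wrap_continuous : continuous wrap.
Proof.
apply: continuous_comp_initial; apply: rV_continuous => i.
pose r (x : D 2) : R := radius (1 - set_val x 0 0).
pose th (x : D 2) : R := set_val x 0 ord_max / (set_val x 0 1 + set_val x 0 ord_max).
have cX i : continuous (fun x : D 2 => set_val x 0 i) := @simplex_coord_continuous _ i.
have c0 : continuous (fun x : D 2 => 1 - set_val x 0 0 : R).
  by apply: ctsB; [exact: cts_cst|exact: cX].
have cr : continuous r by apply: (cts_comp c0); exact: radius_continuous.
have trig (f : R -> R) : continuous f -> (forall y, `|f y| <= 1) ->
    continuous (fun x => r x * f (2 * pi * th x) : R).
  move=> cf f1; apply: cts_polar => //.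
  - by move=> x; exact: radius_ge0.
  - by apply: ctsD; exact: cX.
  - by move=> x s0; rewrite /r -simplex2_sum s0 radius0.
case: (ord3P i) => ->.
- apply: (eq_cts (fun x => crd1_sph _ _)).
  by apply: trig; [exact: continuous_cos|exact: cos_max].
- apply: (eq_cts (fun x => crd2_sph _ _)).
  by apply: trig; [exact: continuous_sin|exact: sin_max].
- apply: (eq_cts (fun x => height_sph _ _)).
  by apply: (cts_comp c0); exact: clamp_continuous.
Qed.

Definition top_simplex (x : D 2) : sphere R := sph 0 1.

Lemma top_simplex_continuous : continuous top_simplex.
Proof. exact: cts_cst. Qed.

(** Faces 1 and 2 of [wrap] coincide and cancel, which leaves the edge that is constant at the north
    pole. The constant triangle has this same edge as its boundary, so the difference is a cycle. *)
Definition fund_cycle : sing_chain R (sphere R) 2 :=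
  << (mkcts wrap_continuous : sing_simplex R (sphere R) 2) >> -
  << (mkcts top_simplex_continuous : sing_simplex R (sphere R) 2) >>.

Lemma wrap_face0 x : wrap (face_fun 0 x) = sph 0 1.
Proof.
have e : set_val (face_fun 0 x) 0 0 = 0 by rewrite /= insert0E eqxx.
by rewrite /wrap e subr0; apply: sph_radius0; exact: radius1.
Qed.

Lemma wrap_face12 x : wrap (face_fun 1 x) = wrap (face_fun ord_max x).
Proof.
set y := face_fun 1 x; set y' := face_fun ord_max x.
have y0 : set_val y 0 0 = set_val x 0 0.
  by rewrite /= insert0E /=; congr (set_val x 0 _); apply/val_inj; rewrite /= inordK.
have y0' : set_val y' 0 0 = set_val x 0 0.
  by rewrite /= insert0E /=; congr (set_val x 0 _); apply/val_inj; rewrite /= inordK.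
have y1 : set_val y 0 1 = 0 by rewrite /= insert0E eqxx.
have y2 : set_val y' 0 ord_max = 0 by rewrite /= insert0E eqxx.
rewrite /wrap y0 y0' y1 y2 mul0r add0r.
have := simplex2_sum y; rewrite y1 y0 add0r => ->.
have [->|n0] := eqVneq (1 - set_val x 0 0) 0.
  by apply: sph_radius0; rewrite radius0.
by rewrite divff // sph01.
Qed.

Lemma fund_cycle_boundary : Defs.boundary fund_cycle = 0.
Proof.
rewrite /fund_cycle /Defs.boundary fgliftB !fglift1 !big_ord_recr !big_ord0 /=.
rewrite !add0r !expr0 expr1 expr2 mulrNN mulr1 !scale1r !scaleN1r.
set i1 : 'I_3 := widen_ord (leqnSn 2) ord_max.
set i0 : 'I_3 := widen_ord _ (widen_ord _ _).
set w := mkcts wrap_continuous; set tp := mkcts top_simplex_continuous.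
have -> : w \o face R i0 = tp \o face R i0 :> sing_simplex R (sphere R) 1.
  apply/continuousEP => x; have -> : i0 = 0 by exact/val_inj.
  exact: wrap_face0.
have -> : w \o face R i1 = w \o face R ord_max :> sing_simplex R (sphere R) 1.
  apply/continuousEP => x; have -> : i1 = 1 by exact/val_inj.
  exact: wrap_face12.
have -> : tp \o face R i1 = tp \o face R ord_max :> sing_simplex R (sphere R) 1.
  exact/continuousEP.
by rewrite !subrK subrr.
Qed.

End Parametrization.

(** * Winding numbers along the latitudes *)

Section Totals.
Variable R : realType.
Implicit Types (s t : R).

Lemma clamp_id s : clamp (clamp s) = clamp s.
Proof. by rewrite clampE // clamp_itv. Qed.

(** The unit square is star-shaped about (0, 0); clamping extends the lift to the plane. *)
Lemma square_lift (p q : R * R -> R) : continuous p -> continuous q ->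
  (forall th t, 0 <= th <= 1 -> 0 <= t <= 1 -> 0 < p (th, t) ^+ 2 + q (th, t) ^+ 2) ->
  exists2 l : R * R -> R, continuous l &
    forall th t, 0 <= th <= 1 -> 0 <= t <= 1 -> polar (l (th, t)) (p (th, t)) (q (th, t)).
Proof.
move=> cp cq pq0.
pose K : set (R * R) := `[0 : R, 1] `*` `[0 : R, 1].
have KP th t : (th, t) \in K <-> 0 <= th <= 1 /\ 0 <= t <= 1.
  by rewrite inE /K /= !in_itv.
have K0 : (0, 0) \in K by apply/KP; rewrite lexx ler01.
have Kc : compact K by apply: compact_setX; exact: segment_compact.
have [|H Hb] := star_contracts (b := SigSub K0 : K) Kc.
  move=> s [x y] /andP[s0 s1] /mem_set /KP [/andP[x0 x1] /andP[y0 y1]] /=.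
  apply: set_mem; apply/KP; rewrite /= !add0r !oppr0 !addr0.
  by rewrite !mulr_ge0 // !mulr_ile1.
have cv : continuous (set_val : K -> R * R) by exact: initial_continuous.
have [||[[th t] /= xK]|l cl lP] := angle_lift Hb (u := p \o set_val) (v := q \o set_val).
- by apply: cts_comp cp.
- by apply: cts_comp cq.
- by have /KP[] := xK; exact: pq0.
have cK (x : R * R) : (clamp x.1, clamp x.2) \in K by apply/KP; rewrite !clamp_itv.
exists (fun x => l (SigSub (cK x))); last first.
  move=> th t th01 t01.
  have e : set_val (SigSub (cK (th, t))) = (th, t).
    by transitivity (clamp th, clamp t); rewrite // !clampE.
  have := lP (SigSub (cK (th, t))).
  by congr polar; [exact: (congr1 p e)|exact: (congr1 q e)].
apply: cts_comp cl; apply: continuous_comp_initial.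
by apply: cts_pair; apply: cts_comp (@clamp_continuous R) => x; [exact: cvg_fst|exact: cvg_snd].
Qed.

Let pi2 : 2 * pi != 0 :> R.
Proof. by rewrite mulf_neq0 ?gt_eqF ?pi_gt0. Qed.

Lemma polar_increment (p q a b : R -> R) : continuous a -> continuous b ->
  (forall th, 0 <= th <= 1 -> polar (a th) (p th) (q th)) ->
  (forall th, 0 <= th <= 1 -> polar (b th) (p th) (q th)) ->
  a 1 - a 0 = b 1 - b 0.
Proof.
move=> ca cb aP bP.
have : (a 0 - b 0) / (2 * pi) = (a 1 - b 1) / (2 * pi).
  apply: (continuous_int_const (f := fun x => (a x - b x) / (2 * pi))).
    by apply: ctsM; [exact: ctsB|exact: cts_cst].
  move=> th th01; have [m ->] := polar_uniq (aP _ th01) (bP _ th01).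
  by exists m; rewrite mulrC mulKf.
by move=> /(congr1 ( *%R^~ (2 * pi))); rewrite /= !divfK //; lra.
Qed.

Variables (p q : R * R -> R) (A : R -> R).
Hypotheses (cp : continuous p) (cq : continuous q) (cA : continuous A).
Hypothesis pqA : forall t a, 0 <= t <= 1 ->
  polar a (p (0, t)) (q (0, t)) -> polar (A t + a) (p (1, t)) (q (1, t)).

Hypothesis A0 : exists k : int, A 0 = 2 * pi * k%:~R.

(** In the application p + i q is one coordinate of a Hopf lift on the square, and [A] is the
    holonomy, the phase between the sides th = 1 and th = 0. Removing it from the angle turned at
    height [t] leaves a multiple of 2 pi, and the term [A 0] makes the total 0 at t = 0, where the
    side collapses to a point. *)
Definition total t (k : int) := exists a : R -> R, [/\ continuous a,
  forall th, 0 <= th <= 1 -> polar (a th) (p (th, t)) (q (th, t)) &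
  a 1 - a 0 - (A t - A 0) = 2 * pi * k%:~R].

Lemma total_uniq t k k' : total t k -> total t k' -> k = k'.
Proof.
move=> [a [ca aP aE]] [b [cb bP bE]].
apply/eqP; rewrite -(eqr_int R); apply/eqP/(mulfI pi2).
by rewrite -aE -bE (polar_increment ca cb aP bP).
Qed.

(** Where p + i q does not vanish on the whole strip it has one continuous angle there; the total is
    then continuous in the height and integer-valued. *)
Lemma total_const s t : 0 <= s -> s <= t -> t <= 1 ->
  (forall th x, 0 <= th <= 1 -> s <= x <= t -> 0 < p (th, x) ^+ 2 + q (th, x) ^+ 2) ->
  exists k, total s k /\ total t k.
Proof.
move=> s0 st t1 pq0; pose g x := s + x * (t - s).
have cg : continuous g.
  apply: ctsD; first exact: cts_cst.
  by apply: ctsM; [move=> x; exact: cvg_id|exact: cts_cst].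
have gI x : 0 <= x <= 1 -> s <= g x <= t.
  by move=> /andP[x0 x1]; rewrite /g; apply/andP; split; nra.
have gI1 x : 0 <= x <= 1 -> 0 <= g x <= 1.
  by move=> /gI /andP[? ?]; apply/andP; split; lra.
have cG : continuous (fun x : R * R => (x.1, g x.2)).
  apply: cts_pair; first by move=> x; exact: cvg_fst.
  by apply: cts_comp cg => x; exact: cvg_snd.
have [|||l cl lP] := @square_lift (fun x => p (x.1, g x.2)) (fun x => q (x.1, g x.2)).
- exact: cts_comp cG cp.
- exact: cts_comp cG cq.
- by move=> th x th01 x01; apply: pq0 => //; exact: gI.
pose f x := (l (1, x) - l (0, x) - (A (g x) - A 0)) / (2 * pi).
have cid : continuous (id : R -> R) by move=> x; exact: cvg_id.
have cl1 (i : R) : continuous (fun x => l (i, x)).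
  by apply: (@cts_comp _ _ _ (fun x => (i, x)) l) cl; apply: cts_pair => //; exact: cts_cst.
have cl2 (x : R) : continuous (fun th => l (th, x)).
  by apply: (@cts_comp _ _ _ (fun th => (th, x)) l) cl; apply: cts_pair => //; exact: cts_cst.
have i0 : (0 : R) <= (0 : R) <= (1 : R) by rewrite lexx ler01.
have i1 : (0 : R) <= (1 : R) <= (1 : R) by rewrite lexx ler01.
have fZ x : 0 <= x <= 1 -> exists k : int,
    l (1, x) - l (0, x) - (A (g x) - A 0) = 2 * pi * k%:~R.
  move=> x01; have [k0 k0E] := A0.
  have [k kE] := polar_uniq (lP _ _ i1 x01) (pqA (gI1 _ x01) (lP _ _ i0 x01)).
  by exists (k + k0); rewrite intrD mulrDr -kE -k0E; lra.
have f01 : f 0 = f 1.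
  apply: continuous_int_const => [|x /fZ[k kE]]; last first.
    by exists k; rewrite /f kE mulrC mulKf.
  apply: ctsM; last exact: cts_cst.
  apply: ctsB; first exact: ctsB.
  by apply: ctsB; [exact: cts_comp cg cA|exact: cts_cst].
have [k kE] := fZ 0 i0.
have g0 : g 0 = s by rewrite /g mul0r addr0.
have g1 : g 1 = t by rewrite /g mul1r addrC subrK.
have T x : 0 <= x <= 1 -> f x = f 0 -> total (g x) k.
  move=> x01 fx; exists (fun th => l (th, x)); split=> //.
    by move=> th th01; exact: lP.
  by rewrite -kE; apply: (mulIf (invr_neq0 pi2)); exact: fx.
by exists k; rewrite -{1}g0 -g1; split; apply: T.
Qed.

End Totals.

(** * The square and the interval as parameters of simplices *)

Section WindingData.
Variable R : realType.
Local Notation D n := (simplex R n).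

(** The square with its side t = 0 collapsed to vertex 0. Followed by [wrap] it gives longitude and
    height, and its sides th = 1, th = 0 and t = 1 are the faces 1, 2 and 0 of the triangle. *)
Definition sq_vec (x : R * R) : 'rV[R]_3 :=
  \row_i [:: 1 - clamp x.2; clamp x.2 * (1 - clamp x.1); clamp x.2 * clamp x.1]`_i.

Lemma sq_subproof x : sq_vec x \in simplex R 2.
Proof.
have /andP[? ?] := clamp_itv x.1; have /andP[? ?] := clamp_itv x.2.
apply/mem_set; split=> [i|].
  case: (ord3P i) => ->; rewrite mxE /=; first by rewrite subr_ge0.
    by apply: mulr_ge0 => //; rewrite subr_ge0.
  exact: mulr_ge0.
by rewrite !big_ord_recr big_ord0 /= !mxE /=; ring.
Qed.

Definition sq x : D 2 := SigSub (sq_subproof x).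

Lemma sq_continuous : continuous sq.
Proof.
have c1 : continuous (fun x : R * R => clamp x.1).
  by apply: cts_comp (@clamp_continuous R) => x; exact: cvg_fst.
have c2 : continuous (fun x : R * R => clamp x.2).
  by apply: cts_comp (@clamp_continuous R) => x; exact: cvg_snd.
apply: continuous_comp_initial; apply: rV_continuous => i.
case: (ord3P i) => ->.
- apply: (@eq_cts _ _ _ (fun x : R * R => 1 - clamp x.2)).
    by move=> x; rewrite /= mxE.
  by apply: ctsB => //; exact: cts_cst.
- apply: (@eq_cts _ _ _ (fun x : R * R => clamp x.2 * (1 - clamp x.1))).
    by move=> x; rewrite /= mxE.
  by apply: ctsM => //; apply: ctsB => //; exact: cts_cst.
- apply: (@eq_cts _ _ _ (fun x : R * R => clamp x.2 * clamp x.1)).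
    by move=> x; rewrite /= mxE.
  exact: ctsM.
Qed.

Lemma clamp0 : clamp (0 : R) = 0. Proof. by rewrite clampE ?lexx ?ler01. Qed.
Lemma clamp1 : clamp (1 : R) = 1. Proof. by rewrite clampE ?lexx ?ler01. Qed.

Lemma wrap_sq th t : 0 <= th <= 1 -> wrap (sq (th, t)) = sph th t.
Proof.
move=> th01; have e0 : set_val (sq (th, t)) 0 0 = 1 - clamp t by rewrite /= mxE.
have e2 : set_val (sq (th, t)) 0 ord_max = clamp t * th by rewrite /= mxE /= (clampE th01).
have sphc th' : sph th' (clamp t) = sph th' t.
  by apply: sphere_eq; rewrite ?crd1_sph ?crd2_sph ?height_sph /radius ?clamp_id.
rewrite /wrap simplex2_sum e0 e2 opprB addrC subrK -[RHS]sphc.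
have [->|t0] := eqVneq (clamp t) 0.
  by apply: sph_radius0; rewrite radius0.
by rewrite mulrAC divff // mul1r.
Qed.

Definition pt_vec (t : R) : 'rV[R]_2 := \row_i [:: 1 - clamp t; clamp t]`_i.

Lemma pt_subproof x : pt_vec x \in simplex R 1.
Proof.
have /andP[? ?] := clamp_itv x.
apply/mem_set; split=> [i|].
  have : (i == 0) || (i == ord_max) by case: i => [[|[]]].
  by move=> /orP[] /eqP ->; rewrite mxE /= ?subr_ge0.
by rewrite !big_ord_recr big_ord0 /= !mxE /=; ring.
Qed.

Definition pt x : D 1 := SigSub (pt_subproof x).

Lemma pt_continuous : continuous pt.
Proof.
apply: continuous_comp_initial; apply: rV_continuous => i.
have : (i == 0) || (i == ord_max) by case: i => [[|[]]].
move=> /orP[] /eqP ->.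
- apply: (@eq_cts _ _ _ (fun x : R => 1 - clamp x)).
    by move=> x; rewrite /= mxE.
  by apply: ctsB; [exact: cts_cst|exact: clamp_continuous].
- apply: (@eq_cts _ _ _ (@clamp R)); last exact: clamp_continuous.
  by move=> x; rewrite /= mxE.
Qed.

Lemma pt0 : pt 0 = vertex R ord0.
Proof.
apply/val_inj/rowP => i /=; rewrite !mxE clamp0 subr0.
by case: i => [[|[]]].
Qed.

Lemma pt1 : pt 1 = vertex R ord_max.
Proof.
apply/val_inj/rowP => i /=; rewrite !mxE clamp1 subrr.
by case: i => [[|[]]].
Qed.

Lemma sq0 th : sq (th, 0) = vertex R ord0.
Proof.
apply/val_inj/rowP => i /=; rewrite !mxE /= clamp0 subr0 !mul0r.
by case: i => [[|[|[]]]].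
Qed.

Lemma face1_pt t : face_fun 1 (pt t) = sq (1, t).
Proof.
apply/val_inj/rowP => i /=; rewrite insert0E !mxE /= clamp1 subrr mulr0 mulr1.
by case: (ord3P i) => ->; rewrite //= ?inordK.
Qed.

Lemma face2_pt t : face_fun ord_max (pt t) = sq (0, t).
Proof.
apply/val_inj/rowP => i /=; rewrite insert0E !mxE /= clamp0 subr0 mulr0 mulr1.
by case: (ord3P i) => ->; rewrite //= ?inordK.
Qed.

Lemma face0_pt th : face_fun 0 (pt th) = sq (th, 1).
Proof.
apply/val_inj/rowP => i /=; rewrite insert0E !mxE /= clamp1 subrr !mul1r.
by case: (ord3P i) => ->; rewrite //= ?inordK.
Qed.

End WindingData.

(** * The two winding numbers of a latitude *)

Section WindingTheorem.
Variable R : realType.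
Local Notation D n := (simplex R n).

Lemma over_a_gt0 (v : spinor R) q : over v q -> height q < 1 ->
  0 < a1 v ^+ 2 + a2 v ^+ 2.
Proof.
case: v => p1 p2 r1 r2 [e1 e2 e3 e4] /=; rewrite /norm2 /= => n0 h1.
have := sqr_ge0 p1; have := sqr_ge0 p2 => p20 p10.
rewrite lt_neqAle addr_ge0 // andbT; apply/negP => /eqP e.
have /eqP p1E : p1 == 0 by rewrite -sqrf_eq0; apply/eqP; lra.
have /eqP p2E : p2 == 0 by rewrite -sqrf_eq0; apply/eqP; lra.
have hn : 1 - height q != 0 by rewrite gt_eqF // subr_gt0.
have /eqP r1E : r1 == 0.
  by move: e3; rewrite p1E p2E !mulr0 subr0 => /esym/eqP; rewrite mulf_eq0 (negPf hn).
have /eqP r2E : r2 == 0.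
  by move: e4; rewrite p1E p2E !mulr0 addr0 => /esym/eqP; rewrite mulf_eq0 (negPf hn).
by move: n0; rewrite p1E p2E r1E r2E expr0n !addr0 ltxx.
Qed.

Lemma over_b_gt0 (v : spinor R) q : over v q -> 0 < height q ->
  0 < b1 v ^+ 2 + b2 v ^+ 2.
Proof.
case: v => p1 p2 r1 r2 [e1 e2 e3 e4] /=; rewrite /norm2 /= => n0 h1.
have := sqr_ge0 r1; have := sqr_ge0 r2 => r20 r10.
rewrite lt_neqAle addr_ge0 // andbT; apply/negP => /eqP e.
have /eqP r1E : r1 == 0 by rewrite -sqrf_eq0; apply/eqP; lra.
have /eqP r2E : r2 == 0 by rewrite -sqrf_eq0; apply/eqP; lra.
have hn : height q != 0 by rewrite gt_eqF.
have /eqP p1E : p1 == 0.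
  by move: e1; rewrite r1E r2E !mulr0 addr0 => /eqP; rewrite mulf_eq0 (negPf hn).
have /eqP p2E : p2 == 0.
  by move: e2; rewrite r1E r2E !mulr0 subr0 => /eqP; rewrite mulf_eq0 (negPf hn).
by move: n0; rewrite p1E p2E r1E r2E expr0n !addr0 ltxx.
Qed.

(** In a fibre (1 - h) b = (x + i y) a, hence (1 - h) b conj(a) = |a|^2 (x + i y): the longitude is
    the argument of b minus that of a. *)
Lemma over_polar (v : spinor R) q s t : over v q -> height q < 1 ->
  polar s (a1 v) (a2 v) -> polar t (b1 v) (b2 v) ->
  polar (t - s) (crd1 q) (crd2 q).
Proof.
move=> vq h1 ps pt; have a0 := over_a_gt0 vq h1.
case: v vq ps pt a0 => p1 p2 r1 r2 [e1 e2 e3 e4 _] /= ps pt a0.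
have h0 : 0 < 1 - height q by rewrite subr_gt0.
rewrite -(polarZ _ _ _ a0); have := polarM pt (polarN ps).
rewrite -(polarZ _ _ _ h0); congr polar.
  have := congr1 ( *%R p1) e3; have := congr1 ( *%R p2) e4; rewrite /=; lra.
have := congr1 ( *%R p1) e4; have := congr1 ( *%R p2) e3; rewrite /=; lra.
Qed.

(** All that the counting of fixed points takes from homology; [c] will be the value of the cocycle
    on the image of the fundamental cycle. Nothing is said of [NS] where [phi] is 1, nor of [NN]
    where [phi] is 0. *)
Record winding_data (g : R -> R -> sphere R) (phi : R -> R) (c : R)
    (NS NN : R -> int) : Prop := WindingData {
  south_const : forall s t, 0 <= s -> s <= t -> t <= 1 ->
    (forall x, s <= x <= t -> phi x < 1) -> NS s = NS t;
  north_const : forall s t, 0 <= s -> s <= t -> t <= 1 ->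
    (forall x, s <= x <= t -> 0 < phi x) -> NN s = NN t;
  south_start : phi 0 < 1 -> NS 0 = 0;
  north_start : 0 < phi 0 -> NN 0 = 0;
  south_end : phi 1 < 1 -> 2 * pi * (NS 1)%:~R = c;
  north_end : 0 < phi 1 -> 2 * pi * (NN 1)%:~R = c;
  latitude_degree : forall t, 0 <= t <= 1 -> 0 < phi t < 1 ->
    exists b : R -> R, [/\ continuous b,
      forall th, 0 <= th <= 1 -> polar (2 * pi * b th) (crd1 (g th t)) (crd2 (g th t))
      & b 1 - b 0 = (NN t - NS t)%:~R]
}.

Theorem winding_data_ex (g : continuousType (sphere R) (sphere R)) (phi : R -> R) :
  (forall th t, 0 <= th <= 1 -> 0 <= t <= 1 -> height (g (sph th t)) = phi t) ->
  exists NS NN : R -> int,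
    winding_data (fun th t => g (sph th t)) phi
      (class (chain_map g (fund_cycle R))) NS NN.
Proof.
move=> hphi.
have cg : continuous g by exact: cts_fun.
pose f : D 2 -> sphere R := g \o @wrap R.
have cf : continuous f by exact: cts_comp (@wrap_continuous R) cg.
have [H Hb] := simplex_contracts R 2.
have [v cv vP] := hopf_lift Hb cf.
have vS th t : 0 <= th <= 1 -> over (v (sq (th, t))) (g (sph th t)).
  by move=> th01; have := vP (sq (th, t)); rewrite /f /= wrap_sq.
have i0 : (0 : R) <= (0 : R) <= (1 : R) by rewrite lexx ler01.
have i1 : (0 : R) <= (1 : R) <= (1 : R) by rewrite lexx ler01.
have face12 : f \o face_fun 1 = f \o face_fun ord_max.
  by apply/funext => x; rewrite /f /= wrap_face12.
have cF i : continuous (face_fun i : D 1 -> D 2) := @face_continuous R 1 i.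
have [H1 Hb1] := simplex_contracts R 1.
(* The sides th = 1 and th = 0 of the square have the same image; [A] is the phase between the two
   lifts along it. *)
have [lA lAP] : exists l, angle_cts l (v \o face_fun 1) (v \o face_fun ord_max).
  apply: (ratio_lift (f := f \o face_fun 1) Hb1); try exact: spinor_cts_comp.
    by move=> x; exact: vP.
  by move=> x; rewrite face12; exact: vP.
pose A t := lA (pt t).
have cA : continuous A by exact: cts_comp (@pt_continuous R) lAP.1.
have AP t : rotated (A t) (v (sq (1, t))) (v (sq (0, t))).
  by rewrite -face1_pt -face2_pt; exact: lAP.2.
have A0 : exists k : int, A 0 = 2 * pi * k%:~R.
  have := AP 0; rewrite !sq0 => r0.
  have [k kE] := rotated_uniq (over_norm2_gt0 (vP _)) r0 (rotated0 _).
  by exists k; rewrite -kE subr0.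
(* The side t = 1 goes to a single point, so the lift along it is compared with a constant vector
   [w]; [B] is the phase. *)
have [w wP] := over_ex (g (sph 0 1)).
have fN x : f (face_fun 0 x) = g (sph 0 1) by rewrite /f /= wrap_face0.
have cw : spinor_cts (fun _ : D 1 => w) by split; exact: cts_cst.
have [lB lBP] : exists l, angle_cts l (v \o face_fun 0) (fun=> w).
  apply: (ratio_lift (f := f \o face_fun 0) Hb1) => //; first exact: spinor_cts_comp.
    by move=> x; exact: vP.
  by move=> x; rewrite /= fN.
pose B t := lB (pt t).
have cB : continuous B by exact: cts_comp (@pt_continuous R) lBP.1.
have BP th : rotated (B th) (v (sq (th, 1))) w.
  by rewrite -face0_pt; exact: lBP.2.
(* The edge turns on faces 1 and 2 differ by the change of holonomy. Face 0 contributes the change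
   of [B] and the edge turn of [w], and the constant triangle removes the latter. *)
have cE : class (chain_map g (fund_cycle R)) = B 1 - B 0 - (A 1 - A 0) :> R.
  rewrite /fund_cycle /chain_map fgliftB !fglift1 classB /class !fglift1.
  have -> : cochain (g \o mkcts (@wrap_continuous R)) = winding f v.
    exact: cochainE.
  pose k : D 2 -> sphere R := g \o @top_simplex R.
  have -> : cochain (g \o mkcts (@top_simplex_continuous R)) = winding k (fun=> w).
    apply: (@cochainE _ k) => //; last by split; exact: cts_cst.
    by apply: cts_comp cg; exact: top_simplex_continuous.
  rewrite /winding.
  have eA : edge_turn (v \o face_fun 1) (f \o face_fun 1) =
      A 1 - A 0 + edge_turn (v \o face_fun ord_max) (f \o face_fun ord_max).
    rewrite face12 /A pt0 pt1; apply: edge_turnD => //.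
    - exact: cts_comp (cF _) cf.
    - exact: spinor_cts_comp.
    - by move=> x; exact: vP.
  have eB : edge_turn (v \o face_fun 0) (f \o face_fun 0) =
      B 1 - B 0 + edge_turn (fun=> w) (f \o face_fun 0).
    rewrite /B pt0 pt1; apply: edge_turnD => //.
    - exact: cts_comp (cF _) cf.
    - by move=> x; rewrite /= fN.
  have fk : f \o face_fun 0 = fun=> g (sph 0 1) by apply/funext => x; exact: fN.
  rewrite eA eB fk /k /top_simplex /comp /=.
  ring.
have cs (c : spinor R -> R) : continuous (c \o v) -> continuous (fun x => c (v (sq x))).
  by move=> cc; exact: cts_comp (@sq_continuous R) cc.
have [ca1 ca2 cb1 cb2] := cv.
pose totS := total (fun x => a1 (v (sq x))) (fun x => a2 (v (sq x))) A.
pose totN := total (fun x => b1 (v (sq x))) (fun x => b2 (v (sq x))) A.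
have SA s t : 0 <= s -> s <= t -> t <= 1 ->
    (forall x, s <= x <= t -> phi x < 1) -> exists k, totS s k /\ totS t k.
  move=> s0 st t1 ph1; apply: total_const => //; try exact: cs.
    by move=> x a _; exact: rotated_polar_a (AP x).
  move=> th x th01 xI; apply: (over_a_gt0 (vS _ _ th01)); rewrite hphi ?ph1 //.
  by case/andP: xI => ? ?; apply/andP; split; lra.
have NA s t : 0 <= s -> s <= t -> t <= 1 ->
    (forall x, s <= x <= t -> 0 < phi x) -> exists k, totN s k /\ totN t k.
  move=> s0 st t1 ph1; apply: total_const => //; try exact: cs.
    by move=> x a _; exact: rotated_polar_b (AP x).
  move=> th x th01 xI; apply: (over_b_gt0 (vS _ _ th01)); rewrite hphi ?ph1 //.
  by case/andP: xI => ? ?; apply/andP; split; lra.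
(* Uniquely determined integers become functions of the height, with default 0 where there is
   none. *)
have pick (P : R -> int -> Prop) : (forall t k k', P t k -> P t k' -> k = k') ->
    exists N : R -> int, forall t k, P t k -> N t = k.
  move=> Pu; exists (fun t => xget 0 [set k | P t k]) => t k Pk.
  by case: xgetP => [k' _ Pk'|/(_ k)//]; exact: Pu Pk' Pk.
have [NS NSE] := pick totS (@total_uniq _ _ _ _).
have [NN NNE] := pick totN (@total_uniq _ _ _ _).
have dual (x t : R) : t <= x <= t -> x = t.
  by move=> tx; apply: le_anti; rewrite andbC.
exists NS, NN; split.
- move=> s t s0 st t1 ph1; have [k [ks kt]] := SA s t s0 st t1 ph1.
  by rewrite (NSE _ _ ks) (NSE _ _ kt).
- move=> s t s0 st t1 ph1; have [k [ks kt]] := NA s t s0 st t1 ph1.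
  by rewrite (NNE _ _ ks) (NNE _ _ kt).
(* At t = 0 the latitude is a point: a constant angle serves and the total is 0. *)
- move=> ph0; apply: NSE; have := over_a_gt0 (vS 0 0 i0); rewrite hphi // => /(_ ph0).
  move=> /polar_ex[a aP]; exists (fun=> a); split; first exact: cts_cst.
    by move=> th _; rewrite sq0 -(sq0 0).
  by rewrite !subrr mulr0.
- move=> ph0; apply: NNE; have := over_b_gt0 (vS 0 0 i0); rewrite hphi // => /(_ ph0).
  move=> /polar_ex[a aP]; exists (fun=> a); split; first exact: cts_cst.
    by move=> th _; rewrite sq0 -(sq0 0).
  by rewrite !subrr mulr0.
(* At t = 1 the lift has phase [B] relative to [w], so its first coordinate turns by B 1 - B 0;
   after removal of the holonomy this is the class. *)
- move=> ph1; have [|k [k1 _]] := SA 1 1 ler01 (lexx _) (lexx _).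
    by move=> x /dual ->.
  rewrite cE (NSE _ _ k1); case: k1 => a [ca aP <-].
  have := over_a_gt0 wP; rewrite hphi // => /(_ ph1) /polar_ex[b bP].
  rewrite (@polar_increment _ _ _ a (fun th => B th + b) ca _ aP); first by ring.
    by apply: ctsD => //; exact: cts_cst.
  by move=> th _; exact: rotated_polar_a (BP th) bP.
- move=> ph1; have [|k [k1 _]] := NA 1 1 ler01 (lexx _) (lexx _).
    by move=> x /dual ->.
  rewrite cE (NNE _ _ k1); case: k1 => a [ca aP <-].
  have := over_b_gt0 wP; rewrite hphi // => /(_ ph1) /polar_ex[b bP].
  rewrite (@polar_increment _ _ _ a (fun th => B th + b) ca _ aP); first by ring.
    by apply: ctsD => //; exact: cts_cst.
  by move=> th _; exact: rotated_polar_b (BP th) bP.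
move=> t t01 /andP[ph0 ph1]; case/andP: (t01) => t0 t1.
have [x|k [k1 _]] := SA t t t0 (lexx _) t1; first by move=> /dual ->.
have [x|m [m1 _]] := NA t t t0 (lexx _) t1; first by move=> /dual ->.
rewrite (NSE _ _ k1) (NNE _ _ m1).
case: k1 => a [ca aP aE]; case: m1 => b [cb bP bE].
have pi2 : 2 * pi != 0 :> R by rewrite mulf_neq0 ?gt_eqF ?pi_gt0.
(* The longitude is the difference of the two arguments, and the common holonomy cancels. *)
exists (fun th => (b th - a th) / (2 * pi)); split.
- by apply: ctsM; [exact: ctsB|exact: cts_cst].
- move=> th th01; rewrite mulrC divfK //.
  by apply: over_polar (vS _ _ th01) _ (aP _ th01) (bP _ th01); rewrite hphi.
- apply: (mulfI pi2); rewrite intrB [RHS]mulrBr -aE -bE -mulrBl mulrC divfK //; ring.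
Qed.

End WindingTheorem.

(** * Counting fixed points *)

Section LatitudeFixedPoints.
Variable R : realType.

Lemma polar_sph (q : sphere R) b h : 0 <= h <= 1 -> height q = h ->
  polar (2 * pi * b) (crd1 q) (crd2 q) -> q = sph b h.
Proof.
move=> h01 hq [r r0 [e1 e2]]; have sE := sphereE q.
have rE : r = radius h.
  apply/eqP; rewrite -(eqrXn2 (n := 2)) ?(ltW r0) ?radius_ge0 // radius2 clampE //.
  have := cos2Dsin2 (2 * pi * b); move=> /(congr1 ( *%R (r ^+ 2))).
  rewrite -hq -sE e1 e2 mulr1 => <-; apply/eqP; ring.
by apply: sphere_eq; rewrite ?crd1_sph ?crd2_sph ?height_sph ?clampE // -rE.
Qed.

Lemma sph_polar (b h : R) : 0 < h < 1 ->
  polar (2 * pi * b) (crd1 (sph b h)) (crd2 (sph b h)).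
Proof.
move=> h01; exists (radius h); first exact: radius_gt0.
by rewrite crd1_sph crd2_sph.
Qed.

Lemma sph_shift (b h : R) (k : int) : 0 < h < 1 -> sph (b + k%:~R) h = sph b h.
Proof.
move=> h01; apply/esym; have /andP[h0 h1] := h01.
have hI : 0 <= h <= 1 by rewrite !ltW.
apply: polar_sph => //; first by rewrite height_sph clampE.
by rewrite mulrDr; apply: polar2pi; exact: sph_polar.
Qed.

Lemma sph_inj (b b' h : R) : 0 < h < 1 -> 0 <= b < 1 -> 0 <= b' < 1 ->
  sph b h = sph b' h -> b = b'.
Proof.
move=> h01 /andP[b0 b1] /andP[c0 c1] e.
have p1 := sph_polar b h01; have p2 := sph_polar b' h01; rewrite -e in p2.
have [k] := polar_uniq p1 p2; rewrite -mulrBr => /mulfI.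
have pi2 : 2 * pi != 0 :> R by rewrite mulf_neq0 ?gt_eqF ?pi_gt0.
move=> /(_ pi2) kE; have k1 : ((-1)%:~R < k%:~R :> R) by rewrite -kE mulrNz; lra.
have k2 : (k%:~R < 1%:~R :> R) by rewrite -kE; lra.
rewrite !ltr_int in k1 k2; have k0 : k = 0 by lia.
by move: kE; rewrite k0 => /eqP; rewrite subr_eq0 => /eqP.
Qed.

Variable g : sphere R -> sphere R.

(** The bound [m] is an integer: nonpositive bounds hold for free, and bounds over disjoint sets of
    heights add up whatever their signs. *)
Definition many_fixed (P : set R) (m : int) := exists s : seq (sphere R),
  [/\ uniq s, m <= (size s)%:Z & forall p, p \in s -> g p = p /\ P (height p)].

Lemma many_fixed0 P m : m <= 0 -> many_fixed P m.
Proof. by move=> m0; exists [::]. Qed.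

Lemma many_fixedS (P Q : set R) m k : P `<=` Q -> k <= m ->
  many_fixed P m -> many_fixed Q k.
Proof.
move=> PQ km [s [us sm sP]]; exists s; split => //; first exact: le_trans sm.
by move=> p /sP[? /PQ].
Qed.

Lemma many_fixedU (P Q : set R) m k : (forall x, P x -> Q x -> False) ->
  many_fixed P m -> many_fixed Q k -> many_fixed (P `|` Q) (m + k).
Proof.
move=> PQ [s [us sm sP]] [t [ut tm tP]]; exists (s ++ t); split.
- rewrite cat_uniq us ut andbT /=; apply/hasPn => p /tP[_ Qp].
  by apply/negP => /sP[_ Pp]; exact: PQ Pp Qp.
- by rewrite size_cat PoszD lerD.
by move=> p; rewrite mem_cat => /orP[/sP[? ?]|/tP[? ?]]; split=> //; [left|right].
Qed.

(** The point at longitude [th] is fixed when b th - th is an integer, and the intermediate value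
    theorem yields one longitude for each [K j]. The value b 1 - 1 is excluded since it could be
    taken at th = 1, which is the same point as th = 0. *)
Lemma latitude_fixed (b : R -> R) (h : R) (m : nat) (K : nat -> int) :
  0 < h < 1 -> continuous b -> injective K ->
  (forall th, 0 <= th <= 1 -> height (g (sph th h)) = h) ->
  (forall th, 0 <= th <= 1 ->
    polar (2 * pi * b th) (crd1 (g (sph th h))) (crd2 (g (sph th h)))) ->
  (forall j, (j < m)%N ->
    Num.min (b 0) (b 1 - 1) <= (K j)%:~R <= Num.max (b 0) (b 1 - 1) /\
    (K j)%:~R != b 1 - 1) ->
  many_fixed [set h] m.
Proof.
move=> h01 cb Kinj hg bP KP; have /andP[h0 h1] := h01.
have hI : 0 <= h <= 1 by rewrite !ltW.
have cf : continuous (fun th => b th - th) by apply: ctsB => // x; exact: cvg_id.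
have ex j : exists th, (j < m)%N -> 0 <= th < 1 /\ b th - th = (K j)%:~R.
  have [jm|] := ltnP j m; last by exists 0.
  have [Kb Kn] := KP j jm.
  have [||th] := @IVT R (fun th => b th - th) 0 1 (K j)%:~R ler01.
  - exact: continuous_subspaceT.
  - by rewrite subr0.
  rewrite in_itv /= => /andP[th0 th1] thE; exists th => _; split=> //.
  rewrite th0 lt_neqAle th1 andbT; apply/eqP => e.
  by move: Kn; rewrite -thE e eqxx.
have [th thP] := choice ex.
exists [seq sph (th j) h | j <- iota 0 m]; split.
- rewrite map_inj_in_uniq ?iota_uniq // => i j.
  rewrite !mem_iota /= add0n => im jm e.
  have [ti iE] := thP i im; have [tj jE] := thP j jm.
  have te := sph_inj h01 ti tj e.
  by apply: Kinj; apply/eqP; rewrite -(eqr_int R) -iE -jE te.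
- by rewrite size_map size_iota.
move=> p /mapP[j]; rewrite mem_iota /= add0n => jm ->.
have [/andP[t0 t1] jE] := thP j jm; split; last by rewrite height_sph clampE.
have t01 : 0 <= th j <= 1 by rewrite t0 ltW.
rewrite [LHS](polar_sph hI (hg _ t01) (bP _ t01)).
by rewrite -[b _](subrK (th j)) jE addrC sph_shift.
Qed.

(** Over one turn b th - th changes by d - 1, so it meets |d - 1| integers, counted up from the
    ceiling or down from the floor of [b 0]. *)
Lemma latitude_fixed_deg (b : R -> R) (h : R) (d : int) :
  0 < h < 1 -> continuous b ->
  (forall th, 0 <= th <= 1 -> height (g (sph th h)) = h) ->
  (forall th, 0 <= th <= 1 ->
    polar (2 * pi * b th) (crd1 (g (sph th h))) (crd2 (g (sph th h)))) ->
  b 1 - b 0 = d%:~R ->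
  many_fixed [set h] (d - 1) /\ many_fixed [set h] (1 - d).
Proof.
move=> h01 cb hg bP bd; split.
  have [d1|d1] := leP (d - 1) 0; first exact: many_fixed0.
  have [m mE] : exists m : nat, d - 1 = m by exists `|d - 1|%N; rewrite gtz0_abs.
  rewrite mE; apply: (latitude_fixed (K := fun j => Num.ceil (b 0) + j%:Z)) (cb) _ _ _ _ => //.
    by move=> i j /addrI [].
  move=> j jm; have /andP[c1 c2] := ceil_itv (b 0).
  have dE : d = m%:Z + 1 by lia.
  have j0 : (0 : R) <= j%:R by rewrite ler0n.
  have jm' : (j%:R + 1 <= m%:R :> R) by rewrite natr1 ler_nat.
  rewrite dE intrD in bd; rewrite intrB in c1.
  rewrite intrD; have lt01 : b 0 <= b 1 - 1 by rewrite -[b 1](subrK (b 0)) bd; lra.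
  rewrite (min_idPl lt01) (max_idPr lt01); split.
    by apply/andP; split; move: bd => /=; lra.
  by rewrite lt_eqF //; move: bd => /=; lra.
have [d1|d1] := leP (1 - d) 0; first exact: many_fixed0.
have [m mE] : exists m : nat, 1 - d = m by exists `|1 - d|%N; rewrite gtz0_abs.
rewrite mE; apply: (latitude_fixed (K := fun j => Num.floor (b 0) - j%:Z)) (cb) _ _ _ _ => //.
  by move=> i j /addrI/oppr_inj [].
move=> j jm; have /andP[c1 c2] := floor_itv (b 0).
have dE : d = 1 - m%:Z by lia.
have j0 : (0 : R) <= j%:R by rewrite ler0n.
have jm' : (j%:R + 1 <= m%:R :> R) by rewrite natr1 ler_nat.
rewrite dE intrB in bd; rewrite intrD in c2.
rewrite intrB; have lt01 : b 1 - 1 <= b 0 by rewrite -[b 1](subrK (b 0)) bd; lra.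
rewrite (min_idPr lt01) (max_idPl lt01); split.
  by apply/andP; split; move: bd => /=; lra.
by rewrite gt_eqF //; move: bd => /=; lra.
Qed.

End LatitudeFixedPoints.

(** * Continuous functions on an interval *)

Section Interval.
Variable R : realType.
Implicit Types (f : R -> R) (a b v : R).

Lemma last_point f a b v : continuous f ->
  (exists2 s, a <= s <= b & f s = v) ->
  exists s, [/\ a <= s <= b, f s = v & forall x, s < x <= b -> f x != v].
Proof.
move=> cf [s0 s0I s0v]; pose S := [set s | a <= s <= b] `&` f @^-1` [set v].
have Scl : closed S.
  apply: closedI.
    have -> : [set s | a <= s <= b] = `[a, b]%classic.
      by apply/seteqP; split => x; rewrite /= in_itv.
    exact: interval_closed.
  exact: ((continuous_closedP f).1 cf _ (@closed_eq _ v)).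
have S0 : S !=set0 by exists s0.
have Sb : has_ubound S by exists b => x [/andP[]].
have [sI sv] : S (sup S).
  by rewrite {1}(closure_id S).1 //; exact: closure_sup.
exists (sup S); split => // x /andP[xs xb]; apply/eqP => xv.
have : x <= sup S.
  apply: ub_le_sup => //; split => //=.
  by case/andP: sI => ? _; apply/andP; split => //; lra.
by rewrite leNgt xs.
Qed.

Lemma first_point f a b v : continuous f ->
  (exists2 s, a <= s <= b & f s = v) ->
  exists s, [/\ a <= s <= b, f s = v & forall x, a <= x < s -> f x != v].
Proof.
move=> cf [s0 /andP[s0a s0b] s0v].
have [||s [/andP[sa sb] sv sP]] := @last_point (fun x => f (a + b - x)) a b v.
- apply: cts_comp cf; apply: ctsB; first exact: cts_cst.
  by move=> x; exact: cvg_id.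
- by exists (a + b - s0); [apply/andP; split; lra|rewrite -s0v; congr f; ring].
exists (a + b - s); split => //; first by apply/andP; split; lra.
move=> x /andP[ax xs]; have := sP (a + b - x).
rewrite (_ : a + b - (a + b - x) = x); last by ring.
by apply; apply/andP; split; lra.
Qed.

Lemma fixed_between f a b : continuous f -> a < b ->
  (f a < a /\ b < f b) \/ (a < f a /\ f b < b) ->
  exists2 h, a < h < b & f h = h.
Proof.
move=> cf ab hab; have cg : continuous (fun x => f x - x).
  by apply: ctsB => // x; exact: cvg_id.
have [||h hI /eqP] := @IVT R (fun x => f x - x) a b 0 (ltW ab).
- exact: continuous_subspaceT.
- rewrite ge_min le_max; case: hab => -[h1 h2]; apply/andP; split; apply/orP.
  + by left; lra.
  + by right; lra.
  + by right; lra.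
  + by left; lra.
rewrite subr_eq0 => /eqP hE; exists h => //; move: hI; rewrite in_itv /= => /andP[ah hb].
rewrite !lt_neqAle ah hb !andbT; apply/andP; split; apply/eqP => e.
  by case: hab => -[]; rewrite e hE ltxx.
by case: hab => -[]; rewrite -?e hE ltxx.
Qed.

(** Uniform continuity at scale 1: for a height function, passing from one pole to the other takes
    an interval of length at least [e]. *)
Lemma oscillation f : continuous f -> exists2 e : R, 0 < e &
  forall s t, 0 <= s <= 1 -> `|s - t| < e -> `|f s - f t| < 1.
Proof.
move=> cf; have [] := (compact_near_coveringP _).1 (@segment_compact R 0 1) R (nbhs (0 : R))
  (fun d x => `|f x - f (x + d)| < 1) _ _.
  move=> x _ /=.
  have c1 : (f p.1) @[p --> (x, 0 : R)] --> f x.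
    by apply: (@cvg_comp _ _ _ fst f); [exact: cvg_fst|exact: cf].
  have c2 : (f (p.1 + p.2)) @[p --> (x, 0 : R)] --> f x.
    have c0 : (p.1 + p.2) @[p --> (x, 0 : R)] --> x + 0.
      by apply: cvgD; [exact: cvg_fst|exact: cvg_snd].
    rewrite addr0 in c0.
    by apply: (@cvg_comp _ _ _ (fun p : R * R => p.1 + p.2) f _ _ _ c0); exact: cf.
  have c : (f p.1 - f (p.1 + p.2)) @[p --> (x, 0 : R)] --> f x - f x.
    by apply: cvgB; [exact: c1|exact: c2].
  rewrite subrr in c.
  by apply: (cvgr0_norm_lt _ c); exact: ltr01.
move=> e /= e0 eP; exists e => // s t s01 st.
have := eP (t - s); rewrite /= sub0r normrN distrC => /(_ st s).
by rewrite /= in_itv /= [s + _]addrC subrK; apply.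
Qed.

End Interval.

(** * Counting along the visits to the poles *)

Section Count.
Variables (R : realType) (g : sphere R -> sphere R) (phi : R -> R).
Variables (c : R) (NS NN : R -> int).
Hypothesis phiE : forall th t, 0 <= th <= 1 -> 0 <= t <= 1 ->
  height (g (sph th t)) = phi t.
Hypothesis cphi : continuous phi.
Hypothesis W : winding_data (fun th t => g (sph th t)) phi c NS NN.

(* This is what C^1 provides: the derivative vanishes at such a pole. *)
Hypothesis south_attracts : forall r, phi 0 = 0 -> 0 < r -> r <= 1 ->
  (forall h, 0 < h < r -> 0 < phi h < 1 /\ 2 <= NN h - NS h) ->
  exists2 s, 0 < s < r & phi s < s.
Hypothesis north_attracts : forall r, phi 1 = 1 -> 0 <= r -> r < 1 ->
  (forall h, r < h < 1 -> 0 < phi h < 1 /\ 2 <= NN h - NS h) ->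
  exists2 s, r < s < 1 & s < phi s.

Let phi_itv t : 0 <= t <= 1 -> 0 <= phi t <= 1.
Proof.
by move=> t01; rewrite -(@phiE 0 t) ?lexx ?ler01 //; exact: height_itv.
Qed.

Lemma fixed_height h : 0 < h < 1 -> phi h = h ->
  many_fixed g [set h] (NN h - NS h - 1) /\ many_fixed g [set h] (1 - (NN h - NS h)).
Proof.
move=> h01 ph; have hI : 0 <= h <= 1 by case/andP: h01 => ? ?; rewrite !ltW.
have [|b [cb bP bE]] := latitude_degree W hI; first by rewrite ph.
apply: (latitude_fixed_deg h01 cb) => //.
by move=> th th01; rewrite phiE.
Qed.

Lemma phi_lt1 t : 0 <= t <= 1 -> phi t != 1 -> phi t < 1.
Proof. by move=> /phi_itv/andP[_ p1] pn; rewrite lt_neqAle pn. Qed.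

Lemma phi_gt0 t : 0 <= t <= 1 -> phi t != 0 -> 0 < phi t.
Proof. by move=> /phi_itv/andP[p1 _] pn; rewrite lt_neqAle eq_sym pn. Qed.

Lemma fixed_south : phi 0 = 0 -> many_fixed g [set 0] 1.
Proof.
move=> p0; exists [:: sph 0 0]; split => // p; rewrite inE => /eqP ->.
have i0 : (0 : R) <= (0 : R) <= (1 : R) by rewrite lexx ler01.
split; last by rewrite /= height_sph clampE.
have hE : height (g (sph 0 0)) = 0 by rewrite phiE.
have := sphereE (g (sph 0 0)); rewrite hE mul0r => e.
have := sqr_ge0 (crd1 (g (sph 0 0))); have := sqr_ge0 (crd2 (g (sph 0 0))) => s1 s2.
have /eqP x0 : crd1 (g (sph 0 0)) == 0 by rewrite -sqrf_eq0; apply/eqP; lra.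
have /eqP y0 : crd2 (g (sph 0 0)) == 0 by rewrite -sqrf_eq0; apply/eqP; lra.
by apply: sphere_eq; rewrite ?crd1_sph ?crd2_sph ?height_sph ?x0 ?y0 ?hE ?radius0
  ?mul0r ?clampE.
Qed.

(** Descending from 1 to 0, [phi] crosses the diagonal at some inner [h]. There [NN] still has its
    value at [s] and [NS] already its value at [r], so the degree on that latitude is NN s - NS
    r. *)
Lemma count_south_step s r : 0 <= s -> s < r -> r <= 1 -> phi s = 1 -> phi r = 0 ->
  (forall x, s < x < r -> 0 < phi x < 1) ->
  many_fixed g [set x | s < x < r] (1 - (NN s - NS r)).
Proof.
move=> s0 sr r1 ps pr pI.
have [|h hI ph] := @fixed_between _ phi s r cphi sr.
  right; split; rewrite ?ps ?pr; lra.
have [hs hr] := andP hI.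
have h01 : 0 < h < 1 by apply/andP; split; lra.
apply: many_fixedS (fixed_height h01 ph).2; first by move=> x ->.
have hS : NS h = NS r.
  apply: (south_const W); try lra.
  move=> x /andP[x1 x2]; have [->|xr] := eqVneq x r; first by rewrite pr.
  have /andP[] : 0 < phi x < 1 by apply: pI; rewrite (lt_le_trans hs x1) lt_neqAle xr.
  by [].
have hN : NN s = NN h.
  apply: (north_const W); try lra.
  move=> x /andP[x1 x2]; have [->|xr] := eqVneq x s; first by rewrite ps.
  have /andP[] : 0 < phi x < 1.
    by apply: pI; rewrite (le_lt_trans x2 hr) lt_neqAle eq_sym xr x1.
  by [].
by rewrite hS hN.
Qed.

(** An ascent crosses the diagonal inside unless it starts at a fixed south pole or ends at a fixed
    north pole. A fixed height is needed only for degree at least 2, and then attraction at the pole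
    supplies a nearby height on the required side of the diagonal. *)
Lemma count_north_step s r : 0 <= s -> s < r -> r <= 1 -> phi s = 0 -> phi r = 1 ->
  (forall x, s < x < r -> 0 < phi x < 1) ->
  many_fixed g [set x | s < x < r] (NN r - NS s - 1).
Proof.
move=> s0 sr r1 ps pr pI.
have [d1|d1] := leP (NN r - NS s - 1) 0; first exact: many_fixed0.
have deg h : s < h < r -> NN h = NN r /\ NS h = NS s.
  move=> /andP[sh hr]; split.
    apply: (north_const W); try lra.
    move=> x /andP[x1 x2]; have [->|xr] := eqVneq x r; first by rewrite pr.
    have /andP[] : 0 < phi x < 1 by apply: pI; rewrite (lt_le_trans sh x1) lt_neqAle xr.
    by [].
  apply/esym; apply: (south_const W); try lra.
  move=> x /andP[x1 x2]; have [->|xr] := eqVneq x s; first by rewrite ps.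
  have /andP[] : 0 < phi x < 1.
    by apply: pI; rewrite (le_lt_trans x2 hr) lt_neqAle eq_sym xr x1.
  by [].
have deg2 h : s < h < r -> 0 < phi h < 1 /\ 2 <= NN h - NS h.
  by move=> hI; split; [exact: pI|have [-> ->] := deg h hI; lia].
(* The midpoint separates the two comparison heights, so that a < b. *)
pose m := (s + r) / 2.
have [a aI pa] : exists2 a, s <= a < m & phi a < a.
  have [s_gt0|] := ltP 0 s.
    by exists s; [rewrite lexx /m; lra|rewrite ps].
  move=> s_le0; have s_eq : s = 0 by lra.
  have p0 : phi 0 = 0 by rewrite -[in LHS]s_eq.
  have [|||a /andP[a1 a2] pa] := south_attracts (r := m) p0.
  - by rewrite /m; lra.
  - by rewrite /m; lra.
  - by move=> h /andP[h1 h2]; apply: deg2; rewrite /m in h2; apply/andP; split; lra.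
  - by exists a => //; apply/andP; split; lra.
have [b bI pb] : exists2 b, m < b <= r & b < phi b.
  have [r_lt1|] := ltP r 1.
    by exists r; [rewrite lexx /m andbT; lra|rewrite pr].
  move=> r_ge1; have r_eq : r = 1 by lra.
  have p1 : phi 1 = 1 by rewrite -[in LHS]r_eq.
  have [|||b /andP[b1 b2] pb] := north_attracts (r := m) p1.
  - by rewrite /m; lra.
  - by rewrite /m; lra.
  - by move=> h /andP[h1 h2]; apply: deg2; rewrite /m in h1; apply/andP; split; lra.
  - by exists b => //; apply/andP; split; lra.
have [a1 a2] := andP aI; have [b1 b2] := andP bI.
have ab : a < b by lra.
have [|h /andP[h1 h2] ph] := @fixed_between _ phi a b cphi ab; first by left.
have hsr : s < h < r by apply/andP; split; lra.
have h01 : 0 < h < 1 by apply/andP; split; lra.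
apply: many_fixedS (fixed_height h01 ph).1; first by move=> x ->.
by have [-> ->] := deg h hsr.
Qed.

(** Induction on the number of intervals of length [e] below [t]: the last visit to the opposite
    pole precedes a passage of length at least [e], so the induction hypothesis applies to it. *)
Lemma count_poles : exists2 e : R, 0 < e & forall (k : nat) t, 0 <= t <= 1 ->
  t < e * k%:R ->
  (phi t = 0 -> many_fixed g [set x | x <= t] (NS t + 1)) /\
  (phi t = 1 -> many_fixed g [set x | x <= t] (NN t)).
Proof.
have [e e0 eP] := oscillation cphi; exists e => //.
have i0 : (0 : R) <= (0 : R) <= (1 : R) by rewrite lexx ler01.
elim=> [|k IH] t t01 tk.
  by move: tk t01; rewrite mulr0 => ? /andP[? ?]; lra.
have [t0 t1] := andP t01.
have sub s : 0 <= s <= t -> 0 <= s <= 1.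
  by move=> /andP[? ?]; apply/andP; split; lra.
have gap s r : 0 <= s -> s <= r -> r <= t -> `|phi s - phi r| = 1 -> s < e * k%:R.
  move=> s0 sr rt pE; have [//|ks] := ltP s (e * k%:R).
  have : `|phi s - phi r| < 1.
    apply: eP; first by apply/andP; split; lra.
    by rewrite ler0_norm; [move: tk; rewrite -natr1 mulrDr mulr1; lra|lra].
  by rewrite pE ltxx.
split=> pt.
  (* From the last visit [s] to the north [phi] first returns to the south at [r]. The bounds NN s
     up to [s] and 1 - (NN s - NS r) in between add up to NS r + 1, and [NS] is constant from [r] to
     [t]. *)
  have [[s1 s1I ps1]|no1] := pselect (exists2 s, 0 <= s <= t & phi s = 1).
    have [s [/andP[s0 st] ps sl]] := last_point cphi (ex_intro2 _ _ s1 s1I ps1).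
    have [|r [/andP[sr rt] pr rf]] := @first_point _ phi s t 0 cphi.
      by exists t; rewrite ?st ?lexx.
    have srn : s < r.
      by rewrite lt_neqAle sr andbT; apply/eqP => e1; move: pr; rewrite -e1 ps; lra.
    have pI x : s < x < r -> 0 < phi x < 1.
      move=> /andP[sx xr]; have x01 : 0 <= x <= 1 by apply/andP; split; lra.
      rewrite phi_gt0 ?rf ?(ltW sx) //=; apply: phi_lt1 => //; apply: sl.
      by rewrite sx; lra.
    have s01 : 0 <= s <= 1 by apply/andP; split; lra.
    have [|_ /(_ ps) c1] := IH s s01.
      by apply: (gap s r) => //; rewrite ps pr subr0 normr1.
    have c2 := count_south_step s0 srn (le_trans rt t1) ps pr pI.
    apply: many_fixedS (many_fixedU _ c1 c2).
    - by move=> x [/= ? |/= /andP[? ?]] /=; lra.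
    - suff -> : NS r = NS t by rewrite (_ : NN s + _ = NS t + 1) //; ring.
      apply: (south_const W) => //; first by lra.
      move=> x /andP[rx xt]; apply: phi_lt1; first by apply/andP; split; lra.
      by apply: sl; apply/andP; split; lra.
    - by move=> x /= ? /andP[? ?]; lra.
  (* Without a visit to the north [NS] is still 0, and one fixed point is wanted: the south pole if
     it is fixed, otherwise a point on a fixed latitude met before the first visit to the south,
     where both integers are 0. *)
  have ph1 x : 0 <= x <= t -> phi x < 1.
    move=> xI; apply: phi_lt1; first exact: sub.
    by apply/eqP => p1; apply: no1; exists x.
  have NSt : NS t = 0.
    rewrite -(south_const W (lexx 0) t0 t1) //; apply: (south_start W).
    by apply: ph1; rewrite lexx.
  rewrite NSt add0r; have [p0|p0] := eqVneq (phi 0) 0.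
    by apply: many_fixedS (fixed_south p0) => // x ->.
  have p0_gt0 := phi_gt0 i0 p0.
  have [|r [/andP[r0 rt] pr rf]] := @first_point _ phi 0 t 0 cphi.
    by exists t; rewrite ?t0 ?lexx.
  have rn : 0 < r.
    by rewrite lt_neqAle r0 andbT; apply/eqP => e1; move: p0 pr; rewrite -e1 => /eqP.
  have [|h /andP[h0 hr] ph] := @fixed_between _ phi 0 r cphi rn.
    by right; rewrite pr.
  have h01 : 0 < h < 1 by apply/andP; split; lra.
  have hNS : NS h = 0.
    rewrite -(south_const W (lexx 0) (ltW h0)) //; first 1 last.
    - by lra.
    - by move=> x /andP[? ?]; apply: ph1; apply/andP; split; lra.
    apply: (south_start W); apply: ph1; by rewrite lexx.
  have hNN : NN h = 0.
    rewrite -(north_const W (lexx 0) (ltW h0)) //; first 1 last.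
    - by lra.
    - move=> x /andP[? ?]; apply: phi_gt0; first by apply/andP; split; lra.
      by apply: rf; apply/andP; split; lra.
    exact: (north_start W).
  apply: many_fixedS (fixed_height h01 ph).2; first by move=> x -> /=; lra.
  by rewrite hNS hNN.
(* The same with the poles exchanged: NS s + 1 and NN r - NS s - 1 add up to NN r. *)
have [[s1 s1I ps1]|no0] := pselect (exists2 s, 0 <= s <= t & phi s = 0).
  have [s [/andP[s0 st] ps sl]] := last_point cphi (ex_intro2 _ _ s1 s1I ps1).
  have [|r [/andP[sr rt] pr rf]] := @first_point _ phi s t 1 cphi.
    by exists t; rewrite ?st ?lexx.
  have srn : s < r.
    by rewrite lt_neqAle sr andbT; apply/eqP => e1; move: pr; rewrite -e1 ps; lra.
  have pI x : s < x < r -> 0 < phi x < 1.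
    move=> /andP[sx xr]; have x01 : 0 <= x <= 1 by apply/andP; split; lra.
    rewrite phi_lt1 ?rf ?(ltW sx) // andbT; apply: phi_gt0 => //; apply: sl.
    by rewrite sx; lra.
  have s01 : 0 <= s <= 1 by apply/andP; split; lra.
  have [|/(_ ps) c1 _] := IH s s01.
    by apply: (gap s r) => //; rewrite ps pr sub0r normrN normr1.
  have c2 := count_north_step s0 srn (le_trans rt t1) ps pr pI.
  apply: many_fixedS (many_fixedU _ c1 c2).
  - by move=> x [/= ? |/= /andP[? ?]] /=; lra.
  - suff -> : NN r = NN t by rewrite (_ : NS s + 1 + _ = NN t) //; ring.
    apply: (north_const W) => //; first by lra.
    move=> x /andP[rx xt]; apply: phi_gt0; first by apply/andP; split; lra.
    by apply: sl; apply/andP; split; lra.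
  - by move=> x /= ? /andP[? ?]; lra.
have ph0 x : 0 <= x <= t -> 0 < phi x.
  move=> xI; apply: phi_gt0; first exact: sub.
  by apply/eqP => p1; apply: no0; exists x.
apply: many_fixed0; rewrite -(north_const W (lexx 0) t0 t1) //.
by rewrite (north_start W) //; apply: ph0; rewrite lexx.
Qed.

(** After the last visit to a pole [phi] stays strictly between 0 and 1, so the integer counted at
    that visit keeps its value up to height 1, where it is [d]. If there is no visit, [d] is 0. *)
Theorem count_fixed (d : int) : c = 2 * pi * d%:~R -> many_fixed g setT d.
Proof.
move=> cE; have [e e0 eP] := count_poles.
have i1 : (0 : R) <= (1 : R) <= (1 : R) by rewrite lexx ler01.
have pi2 : 2 * pi != 0 :> R by rewrite mulf_neq0 ?gt_eqF ?pi_gt0.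
have P t : 0 <= t <= 1 ->
  (phi t = 0 -> many_fixed g [set x | x <= t] (NS t + 1)) /\
  (phi t = 1 -> many_fixed g [set x | x <= t] (NN t)).
  move=> t01; apply: (eP (Num.bound (t / e))) => //.
  rewrite mulrC -ltr_pdivrMr //; apply: archi_boundP.
  by case/andP: t01 => ? ?; rewrite divr_ge0 // ltW.
have dS : phi 1 < 1 -> d = NS 1.
  move=> p1; apply/eqP; rewrite -(eqr_int R); apply/eqP/(mulfI pi2).
  by rewrite -cE (south_end W).
have dN : 0 < phi 1 -> d = NN 1.
  move=> p1; apply/eqP; rewrite -(eqr_int R); apply/eqP/(mulfI pi2).
  by rewrite -cE (north_end W).
have [[s1 s1I ps1]|no] := pselect (exists2 s, 0 <= s <= 1 & phi s * (1 - phi s) = 0).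
  have cq : continuous (fun x => phi x * (1 - phi x)).
    by apply: ctsM => //; apply: ctsB => //; exact: cts_cst.
  have [s [s01 ps sl]] := last_point cq (ex_intro2 _ _ s1 s1I ps1).
  have [s0 s1'] := andP s01.
  have pI x : s < x <= 1 -> phi x != 0 /\ phi x != 1.
    move=> xI; have := sl x xI; rewrite mulf_eq0 negb_or subr_eq0 [1 == _]eq_sym.
    by move=> /andP[].
  have [p0|p0] := eqVneq (phi s) 0.
    have := (P s s01).1 p0.
    apply: many_fixedS => //; suff -> : d = NS s by rewrite lerDl.
    have ph1 x : s <= x <= 1 -> phi x < 1.
      move=> /andP[sx x1]; have [->|xs] := eqVneq x s; first by rewrite p0.
      apply: phi_lt1; first by apply/andP; split; lra.
      by apply: (pI x _).2; rewrite lt_neqAle eq_sym xs sx.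
    rewrite dS; last by apply: ph1; rewrite s1' lexx.
    by apply/esym; apply: (south_const W).
  have p1 : phi s = 1.
    by move/eqP: ps; rewrite mulf_eq0 (negPf p0) /= subr_eq0 => /eqP.
  have := (P s s01).2 p1; apply: many_fixedS => //; suff -> : d = NN s by [].
  have ph1 x : s <= x <= 1 -> 0 < phi x.
    move=> /andP[sx x1]; have [->|xs] := eqVneq x s; first by rewrite p1.
    apply: phi_gt0; first by apply/andP; split; lra.
    by apply: (pI x _).1; rewrite lt_neqAle eq_sym xs sx.
  rewrite dN; last by apply: ph1; rewrite s1' lexx.
  by apply/esym; apply: (north_const W).
apply: many_fixed0.
have ph1 x : 0 <= x <= 1 -> phi x < 1.
  move=> xI; apply: phi_lt1 => //; apply/eqP => p1; apply: no; exists x => //.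
  by rewrite p1 subrr mulr0.
rewrite dS ?ph1 // -(south_const W (lexx 0) ler01 (lexx 1)) //.
by rewrite (south_start W) // ph1 // lexx ler01.
Qed.

End Count.

(** * Behaviour at a fixed pole *)

Section Pole.
Variable R : realType.
Implicit Types (g f : sphere R -> sphere R) (p q : sphere R).

(** Differentiability at one point of a local ambient extension. This form passes to iterates
    through composition. *)
Definition differentiable_at g p := exists2 F : 'rV[R]_3 -> 'rV[R]_3,
  differentiable F (set_val p) &
  \forall x \near set_val p, forall q, set_val q = x -> F x = set_val (g q).

Lemma differentiable_at_id p : differentiable_at id p.
Proof.
exists id; first exact: ex_diff.
by apply: (@filterE _ (nbhs (set_val p)) (nbhs_filter _)) => x q ->.
Qed.

Lemma differentiable_at_comp g f p : differentiable_at f p ->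
  differentiable_at g (f p) -> differentiable_at (g \o f) p.
Proof.
move=> [F dF FE] [G dG GE]; have Fp : F (set_val p) = set_val (f p).
  exact: (nbhs_singleton FE).
exists (G \o F).
  by apply: (@differentiable_comp _ _ _ _ F G); [exact: dF|rewrite Fp; exact: dG].
have Fc : F x @[x --> set_val p] --> F (set_val p) := differentiable_continuous dF.
rewrite Fp in Fc.
have GFE : \forall x \near set_val p,
  forall q, set_val q = F x -> G (F x) = set_val (g q) := Fc _ GE.
near=> x => q xq /=.
have Fx : F x = set_val (f q) by apply: (near FE x) xq.
by apply: (near GFE x).
Unshelve. all: by end_near. Qed.

Lemma norm_coord_le (x : 'rV[R]_3) i : `|x 0 i| <= `|x|.
Proof. by rewrite [leRHS]/Num.norm /= mx_normrE; apply: (le_bigmax _ _ (0, i)). Qed.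

Lemma norm_le_coord (x : 'rV[R]_3) c : 0 <= c -> (forall i, `|x 0 i| <= c) -> `|x| <= c.
Proof.
move=> c0 xc; rewrite [leLHS]/Num.norm /= mx_normrE; apply: bigmax_le => // -[i j] _ /=.
by rewrite ord1.
Qed.

Definition direction (th : R) : 'rV[R]_3 :=
  \row_i [:: cos (2 * pi * th); sin (2 * pi * th); 0]`_i.

Lemma sph_vecE (th h : R) : 0 <= h <= 1 ->
  sph_vec th h = radius h *: direction th + h *: delta_mx 0 ord_max.
Proof.
move=> h01; apply/rowP => i; rewrite !mxE.
by case: (ord3P i) => ->; rewrite /= ?mulr0 ?addr0 // add0r mulr1 clampE.
Qed.

(** [L th] is the derivative of an ambient extension at the pole in the horizontal direction [th].
    The vertical displacement is of second order in the radius, so to first order the horizontal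
    coordinates of the image are those of radius times [L], uniformly in the longitude. *)
Lemma pole_estimate g (hp : R) : hp = 0 \/ hp = 1 -> g (sph 0 hp) = sph 0 hp ->
  differentiable_at g (sph 0 hp) ->
  exists L : R -> 'I_3 -> R,
  (forall th th' om k i, direction th' - direction th = k *: direction om ->
     L th' i - L th i = k * L om i) /\
  forall e, 0 < e -> exists2 d, 0 < d & forall h th i, 0 < h < 1 -> `|h - hp| < d ->
    i != ord_max ->
    `|set_val (g (sph th h)) 0 i - radius h * L th i| <= e * radius h.
Proof.
move=> hp01 gp [F dF FE].
set P := set_val (sph 0 hp) in dF FE.
pose L th i := ('d F P (direction th)) 0 i.
exists L; split.
  move=> th th' om k i e; rewrite /L.
  have : 'd F P (direction th' - direction th) = 'd F P (k *: direction om) by rewrite e.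
  rewrite linearB linearZ => /(congr1 (fun x : 'rV[R]_3 => x 0 i)).
  by rewrite !mxE.
move=> e e0.
pose C := `|'d F P (delta_mx 0 ord_max)|.
have hpI : 0 <= hp <= 1 by case: hp01 => ->; rewrite lexx ler01.
have rhp : radius hp = 0 by case: hp01 => ->; rewrite ?radius0 ?radius1.
have PE : P = hp *: delta_mx 0 ord_max by rewrite -[P]/(sph_vec 0 hp) sph_vecE // rhp scale0r add0r.
have FP0 : forall q, set_val q = P -> F P = set_val (g q) := nbhs_singleton FE.
have FP : F P = P by rewrite (FP0 (sph 0 hp)) // gp.
have e2 : 0 < e / 2 by rewrite divr_gt0.
have /eqaddoP/(_ _ e2)/= := diff_locally dF.
move=> /nbhs_ballP[d1 /= d1_gt0 d1P].
move: FE => /nbhs_ballP[d2 /= d2_gt0 d2P].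
have C0 : 0 <= C by exact: normr_ge0.
(* A radius below [m] lies in both neighbourhoods and bounds the vertical contribution, at most 2
   r^2 C, by e r / 2; the other half of the error is the remainder of the derivative. *)
pose m := Num.min d1 (Num.min d2 (e / (4 * (C + 1)))).
have m_gt0 : 0 < m.
  by rewrite !lt_min d1_gt0 d2_gt0 divr_gt0 // mulr_gt0 // ltr_wpDl.
exists (Num.min (1 / 2) (m ^+ 2)).
  by rewrite lt_min divr_gt0 // exprn_gt0.
move=> h th i /andP[h0 h1]; rewrite lt_min => /andP[hd hm] i_max.
have hI : 0 <= h <= 1 by rewrite !ltW.
set r := radius h; have r0 : 0 < r by apply: radius_gt0; rewrite h0.
set t := `|h - hp| in hd hm.
have t0 : 0 <= t by exact: normr_ge0.
(* As t < 1/2, this yields both t <= 2 r^2 and r^2 <= t < m^2. *)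
have r2 : r ^+ 2 = t * (1 - t).
  rewrite /r radius2 clampE // /t; case: hp01 => ->.
    by rewrite subr0 gtr0_norm.
  by rewrite ltr0_norm ?subr_lt0 //; ring.
have tr : t <= r by rewrite -(ler_pXn2r (n := 2)) ?nnegrE ?(ltW r0) // r2; nra.
have t2r : t <= 2 * r ^+ 2 by rewrite r2; nra.
have rm : r < m.
  rewrite -(ltr_pXn2r (n := 2)) ?nnegrE ?(ltW r0) ?(ltW m_gt0) //.
  by apply: le_lt_trans hm; rewrite r2; nra.
move: rm; rewrite !lt_min => /and3P[rd1 rd2 rC].
pose x := r *: direction th + (h - hp) *: delta_mx 0 ord_max.
have xE : x + P = set_val (sph th h).
  by rewrite -[RHS]/(sph_vec th h) sph_vecE // PE /x scalerBl addrA subrK.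
have xr : `|x| <= r.
  apply: norm_le_coord; first exact: ltW.
  move=> j; rewrite !mxE; case: (ord3P j) => -> /=.
  - by rewrite mulr0 addr0 normrM gtr0_norm // ler_piMr ?cos_max // ltW.
  - by rewrite mulr0 addr0 normrM gtr0_norm // ler_piMr ?sin_max // ltW.
  - by rewrite mulr0 add0r mulr1.
have b1 := d1P x; rewrite -ball_normE /= sub0r normrN in b1.
have {}b1 : `|F (x + P) - (F P + 'd F P x)| <= e / 2 * `|x|.
  exact: b1 (le_lt_trans xr rd1).
have b2 : F (x + P) = set_val (g (sph th h)).
  apply: d2P => //; rewrite -ball_normE /= opprD addrCA subrr addr0 normrN.
  exact: le_lt_trans rd2.
have /(le_trans (norm_coord_le _ i)) := b1.
rewrite b2 FP.
have -> : ('d F P x) = r *: 'd F P (direction th) + (h - hp) *: 'd F P (delta_mx 0 ord_max).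
  by rewrite /x linearD !linearZ.
have P0 : P 0 i = 0 by rewrite PE !mxE (negPf i_max) andbF mulr0.
have entryE (u v a w : 'rV[R]_3) k l :
  (u - (v + (k *: a + l *: w))) 0 i = u 0 i - (v 0 i + (k * a 0 i + l * w 0 i)).
  by rewrite !mxE.
rewrite entryE P0 add0r; set c := 'd F P (delta_mx 0 ord_max).
rewrite -/(L th i) => b3.
have cC : `|(h - hp) * c 0 i| <= e / 2 * r.
  rewrite normrM -/t; apply: (@le_trans _ _ (t * C)).
    by rewrite ler_wpM2l // norm_coord_le.
  have rC' : r * (4 * (C + 1)) < e.
    by rewrite -ltr_pdivlMr // mulr_gt0 // ltr_wpDl.
  nra.
move: b3 cC; set u := set_val (g (sph th h)) 0 i; set w := (h - hp) * c 0 i => b3 cC.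
have xe : e / 2 * `|x| <= e / 2 * r by rewrite ler_wpM2l // ltW.
have := ler_normD (u - (r * L th i + w)) w.
rewrite (_ : u - (r * L th i + w) + w = u - r * L th i); last by ring.
lra.
Qed.

End Pole.

(** * Attraction at a fixed pole *)

Section PoleAttracts.
Variable R : realType.

(** The increments of [b] over [d] consecutive intervals of length 1 / d have mean 1, so one is at
    least 1 and one at most 1; the intermediate value theorem finds one equal to 1. *)
Lemma unit_chord (b : R -> R) (d : nat) : (0 < d)%N -> continuous b ->
  b 1 - b 0 = d%:R ->
  exists th, [/\ 0 <= th, th + d%:R^-1 <= 1 & b (th + d%:R^-1) - b th = 1].
Proof.
move=> d0 cb bd; pose e : R := d%:R^-1.
have dR : 0 < d%:R :> R by rewrite ltr0n.
have de : d%:R * e = 1 by rewrite divff // gt_eqF.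
pose u x := b (x + e) - b x.
have cu : continuous u.
  apply: ctsB => //; apply: cts_comp cb.
  by apply: ctsD; [move=> x; exact: cvg_id|exact: cts_cst].
have su : \sum_(0 <= k < d) u (k%:R * e) = d%:R.
  rewrite (eq_bigr (fun k => b (k.+1%:R * e) - b (k%:R * e))); last first.
    by move=> k _; rewrite /u -natr1 mulrDl mul1r.
  by rewrite telescope_sumr // de mul0r.
have sum1 : \sum_(0 <= k < d) (1 : R) = d%:R by rewrite big_const_nat iter_addr subn0 addr0.
have [k1 k1d u1] : exists2 k, (k < d)%N & 1 <= u (k%:R * e).
  apply: contrapT => no; have : \sum_(0 <= k < d) u (k%:R * e) < \sum_(0 <= k < d) (1 : R).
    apply: ltr_sum_nat => // k /andP[_ kd]; rewrite ltNge; apply/negP => uk.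
    by apply: no; exists k.
  by rewrite su sum1 ltxx.
have [k2 k2d u2] : exists2 k, (k < d)%N & u (k%:R * e) <= 1.
  apply: contrapT => no; have : \sum_(0 <= k < d) (1 : R) < \sum_(0 <= k < d) u (k%:R * e).
    apply: ltr_sum_nat => // k /andP[_ kd]; rewrite ltNge; apply/negP => uk.
    by apply: no; exists k.
  by rewrite su sum1 ltxx.
have e0 : 0 < e by rewrite invr_gt0.
have bnd k : (k < d)%N -> 0 <= k%:R * e /\ k%:R * e + e <= 1.
  move=> kd; rewrite mulr_ge0 ?ler0n ?(ltW e0) //; split=> //.
  by rewrite -[X in _ + X]mul1r -mulrDl natr1 -[leRHS]de ler_wpM2r ?(ltW e0) // ler_nat.
have [p1 q1] := bnd _ k1d; have [p2 q2] := bnd _ k2d.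
have [le12|le21] := leP (k1%:R * e) (k2%:R * e).
  have [||th] := @IVT R u _ _ 1 le12; first exact: continuous_subspaceT.
    by rewrite ge_min le_max u1 u2 orbT.
  rewrite in_itv /= => /andP[t1 t2] uth; exists th; rewrite -/e; split; [lra|lra|exact: uth].
have [||th] := @IVT R u _ _ 1 (ltW le21); first exact: continuous_subspaceT.
  by rewrite ge_min le_max u1 u2 orbT.
rewrite in_itv /= => /andP[t1 t2] uth; exists th; rewrite -/e; split; [lra|lra|exact: uth].
Qed.

(** The chord of an arc of [e] turns has length 2 sin (pi e) up to sign and points a quarter turn
    ahead of the middle of the arc. *)
Lemma direction_chord (th e : R) : direction (th + e) - direction th =
  (2 * sin (pi * e)) *: direction (th + e / 2 + 1 / 4).
Proof.
have p2 : 2 * pi * (th + e / 2 + 1 / 4) = 2 * pi * th + pi * e + pi / 2 by field.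
have p1 : 2 * pi * (th + e) = 2 * pi * th + pi * e + pi * e by field.
have p0 : 2 * pi * th = 2 * pi * th + pi * e - pi * e by field.
apply/rowP => i; rewrite !mxE p2 p1; rewrite [in X in _ - X]p0.
set m := 2 * pi * th + pi * e.
case: (ord3P i) => -> /=.
- rewrite cosDpihalf cosD cosB; ring.
- rewrite sinDpihalf sinD sinB; ring.
- by rewrite subrr mulr0.
Qed.

Variable g : sphere R -> sphere R.

(** Two points of the latitude that are 1 / d of a turn apart have the same image, so the derivative
    is small along their chord, of direction [om]. The point at longitude [om] is then sent close to
    the pole, and all images of the latitude share its height. The longitude [om] varies with [h],
    hence the need for a uniform estimate. *)
Lemma pole_attracts (phi : R -> R) (hp : R) (d : nat) :
  (forall th t, 0 <= t <= 1 -> height (g (sph th t)) = phi t) ->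
  continuous phi -> hp = 0 \/ hp = 1 -> phi hp = hp ->
  differentiable_at g (sph 0 hp) -> (2 <= d)%N ->
  exists2 e, 0 < e & forall h, 0 < h < 1 -> `|h - hp| < e -> 0 < phi h < 1 ->
    (exists b : R -> R, [/\ continuous b,
      forall th, 0 <= th <= 1 ->
        polar (2 * pi * b th) (crd1 (g (sph th h))) (crd2 (g (sph th h))) &
      b 1 - b 0 = d%:R]) ->
    `|phi h - hp| < `|h - hp|.
Proof.
move=> phiE cphi hp01 php gd d2.
have hpI : 0 <= hp <= 1 by case: hp01 => ->; rewrite lexx ler01.
have i0 : (0 : R) <= (0 : R) <= (1 : R) by rewrite lexx ler01.
have gp : g (sph 0 hp) = sph 0 hp.
  have hE : height (g (sph 0 hp)) = hp by rewrite phiE.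
  have := sphereE (g (sph 0 hp)); rewrite hE.
  have -> : hp * (1 - hp) = 0 by case: hp01 => ->; rewrite ?subrr ?mulr0 ?mul0r.
  have := sqr_ge0 (crd1 (g (sph 0 hp))); have := sqr_ge0 (crd2 (g (sph 0 hp))) => s1 s2 e.
  have /eqP x0 : crd1 (g (sph 0 hp)) == 0 by rewrite -sqrf_eq0; apply/eqP; lra.
  have /eqP y0 : crd2 (g (sph 0 hp)) == 0 by rewrite -sqrf_eq0; apply/eqP; lra.
  have rhp : radius hp = 0 by case: hp01 => ->; rewrite ?radius0 ?radius1.
  by apply: sphere_eq; rewrite ?crd1_sph ?crd2_sph ?height_sph ?x0 ?y0 ?hE ?rhp
    ?mul0r ?clampE.
have [L [Llin Lest]] := pole_estimate hp01 gp gd.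
have d0 : (0 < d)%N by apply: leq_trans d2.
have dR : 2 <= d%:R :> R by rewrite ler_nat.
pose k := 2 * sin (pi * (d%:R^-1)) : R.
have k0 : 0 < k.
  rewrite mulr_gt0 // sin_gt0_pi // mulr_gt0 ?pi_gt0 ?invr_gt0 ?ltr0n //=.
  by rewrite -[ltRHS]mulr1 ltr_pM2l ?pi_gt0 // invf_lt1 ?ltr0n //; lra.
(* The estimates at the two ends of the chord and at [om] give k |y| <= 2 e r + k e r for each
   horizontal coordinate y of the image; this [e] makes the right side k r / 4. *)
pose e := k / (4 * (k + 2)).
have k2 : 0 < 4 * (k + 2) by lra.
have e0 : 0 < e by rewrite divr_gt0.
have eE : e * (4 * (k + 2)) = k by rewrite divfK ?gt_eqF.
have [r1 r1_gt0 r1P] := Lest e e0.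
have : \forall h \near hp, `|phi h - hp| < 1 / 2.
  have c : (phi h - hp) @[h --> hp] --> phi hp - hp.
    by apply: cvgB; [exact: cphi|exact: cvg_cst].
  rewrite php subrr in c.
  by apply: (cvgr0_norm_lt _ c); rewrite divr_gt0.
move=> /nbhs_ballP[r2 /= r2_gt0 r2P].
exists (Num.min r1 r2); first by rewrite lt_min r1_gt0.
move=> h h01; rewrite lt_min => /andP[hr1 hr2] ph01 [b [cb bP bd]].
have [h0 h1] := andP h01; have hI : 0 <= h <= 1 by rewrite !ltW.
have pI : 0 <= phi h <= 1 by case/andP: ph01 => ? ?; rewrite !ltW.
have [th [th0 th1 bth]] := unit_chord d0 cb bd.
set th' := th + d%:R^-1 in th1 bth.
have ei : 0 < d%:R^-1 :> R by rewrite invr_gt0 ltr0n.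
have thI : 0 <= th <= 1 by apply/andP; split; rewrite /th' in th1; lra.
have thI' : 0 <= th' <= 1 by rewrite th1 andbT /th'; lra.
have gE : g (sph th' h) = g (sph th h).
  rewrite (polar_sph pI (phiE _ _ hI) (bP _ thI')).
  rewrite (polar_sph pI (phiE _ _ hI) (bP _ thI)).
  by rewrite -(sph_shift (b th) 1 ph01); congr sph; rewrite -bth addrC subrK.
pose om := th + d%:R^-1 / 2 + 1 / 4.
set r := radius h; have r0 : 0 < r by exact: radius_gt0.
have small i : i != ord_max -> `|set_val (g (sph om h)) 0 i| <= r / 4.
  move=> iM; have Lk : L th' i - L th i = k * L om i := Llin _ _ _ _ i (direction_chord th d%:R^-1).
  have p1 := r1P h th i h01 hr1 iM; have p2 := r1P h th' i h01 hr1 iM.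
  have p3 := r1P h om i h01 hr1 iM.
  rewrite gE in p2; move: p1 p2 p3; rewrite -/r.
  set x := set_val (g (sph th h)) 0 i; set y := set_val (g (sph om h)) 0 i.
  rewrite !ler_norml => /andP[p1 p1'] /andP[p2 p2'] /andP[p3 p3'].
  have A1 : k * (r * L om i) <= 2 * e * r by rewrite [k * _]mulrCA -Lk; lra.
  have A2 : - (2 * e * r) <= k * (r * L om i) by rewrite [k * _]mulrCA -Lk; lra.
  have kr : e * (4 * (k + 2)) * r = k * r by rewrite eE.
  have q1 : k * y <= k * (r / 4) by nra.
  have q2 : k * - (r / 4) <= k * y by nra.
  by rewrite ler_pM2l // in q1; rewrite ler_pM2l // in q2; apply/andP.
have s1 := small 0 isT; have s2 := small 1 isT.
have sE := sphereE (g (sph om h)).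
have hom : height (g (sph om h)) = phi h by exact: phiE.
rewrite hom in sE.
have n1 : crd1 (g (sph om h)) ^+ 2 <= (r / 4) ^+ 2.
  by rewrite -real_normK ?num_real // ler_pXn2r // nnegrE // divr_ge0 // ltW.
have n2 : crd2 (g (sph om h)) ^+ 2 <= (r / 4) ^+ 2.
  by rewrite -real_normK ?num_real // ler_pXn2r // nnegrE // divr_ge0 // ltW.
have rE : r ^+ 2 = h * (1 - h) by rewrite /r radius2 clampE.
have pm : phi h * (1 - phi h) <= h * (1 - h) / 4.
  by rewrite -sE -rE; move: n1 n2; rewrite !expr_div_n; nra.
(* A small phi (1 - phi) only says that the image is near some pole; continuity selects the pole
   [hp]. *)
have half : `|phi h - hp| < 1 / 2.
  by apply: r2P; rewrite -ball_normE /= distrC.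
case/andP: ph01 => ph0 ph1.
case: hp01 half => ->.
  by rewrite !subr0 !gtr0_norm // => half; nra.
by rewrite !ltr0_norm ?subr_lt0 // => half; nra.
Qed.

End PoleAttracts.

(** * The theorem *)

Section Assembly.
Variable R : realType.

Lemma height_pole_inj (p q : sphere R) : height p = height q ->
  height p * (1 - height p) = 0 -> p = q.
Proof.
move=> e h0; have zero (x : sphere R) : height x * (1 - height x) = 0 -> crd1 x = 0 /\ crd2 x = 0.
  move=> hx; have := sphereE x; rewrite hx.
  have := sqr_ge0 (crd1 x); have := sqr_ge0 (crd2 x) => s1 s2 e'.
  by split; apply/eqP; rewrite -sqrf_eq0; apply/eqP; lra.
have [x1 x2] := zero p h0; rewrite e in h0; have [y1 y2] := zero q h0.
by apply: sphere_eq; rewrite ?x1 ?x2 ?y1 ?y2.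
Qed.

(** Off the poles both points lie on one latitude; at a pole the height determines the point. *)
Lemma preserves_latitudes_height (f : sphere R -> sphere R) p q :
  preserves_latitudes f -> height p = height q -> height (f p) = height (f q).
Proof.
move=> fL e; have /andP[h0 h1] := height_itv p.
have [hE|hn] := eqVneq (height p * (1 - height p)) 0.
  by rewrite (height_pole_inj e hE).
have hI : 0 < height p < 1.
  move: hn; rewrite mulf_eq0 negb_or subr_eq0 => /andP[n0 n1].
  by rewrite !lt_neqAle h0 h1 eq_sym n0 eq_sym n1.
have pL : latitude (height p) p by [].
have qL : latitude (height p) q by [].
have [[h' _ sub]|sub|sub] := fL _ hI.
- by rewrite (sub _ (imageP f pL)) (sub _ (imageP f qL)).
- by rewrite (sub _ (imageP f pL)) (sub _ (imageP f qL)).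
- by rewrite (sub _ (imageP f pL)) (sub _ (imageP f qL)).
Qed.

Lemma iter_height (f : sphere R -> sphere R) n p q :
  preserves_latitudes f -> height p = height q ->
  height (iter n f p) = height (iter n f q).
Proof.
by move=> fL e; elim: n => //= n IH; exact: preserves_latitudes_height.
Qed.

Lemma iter_differentiable (f : sphere R -> sphere R) n p :
  C1_sphere f -> differentiable_at (iter n f) p.
Proof.
move=> fC; elim: n => [|n IH]; first exact: differentiable_at_id.
apply: (@differentiable_at_comp _ f (iter n f)) => //.
have [U [F [oU Up [dF _] FE]]] := fC (iter n f p).
exists F; first exact: dF.
have : nbhs (set_val (iter n f p)) U by apply: open_nbhs_nbhs; split.
by apply: filterS => x Ux q xq; rewrite -xq FE // xq.
Qed.

Lemma sph_continuous th : continuous (sph th : R -> sphere R).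
Proof.
apply: continuous_comp_initial; apply: rV_continuous => i.
case: (ord3P i) => ->.
- apply: (eq_cts (fun x => crd1_sph th x)).
  by apply: ctsM; [exact: radius_continuous|exact: cts_cst].
- apply: (eq_cts (fun x => crd2_sph th x)).
  by apply: ctsM; [exact: radius_continuous|exact: cts_cst].
- by apply: (eq_cts (fun x => height_sph th x)); exact: clamp_continuous.
Qed.

(** The winding data of the identity compute it: on the latitude of height 1/2, of degree 1, [NS] is
    0, so [NN] is 1 there and up to the north pole. *)
Lemma class_fund_cycle : class (fund_cycle R) = 2 * pi :> R.
Proof.
have ci : continuous (id : sphere R -> sphere R) by move=> x; exact: cvg_id.
have [NS [NN W]] := @winding_data_ex _ (mkcts ci) id
  (fun th t th01 t01 => etrans (height_sph th t) (clampE t01)).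
have -> : class (fund_cycle R) = class (chain_map (mkcts ci) (fund_cycle R)).
  congr class; rewrite /chain_map fgliftE -[LHS]freeg_sumE.
  apply: eq_bigr => s _; rewrite (_ : mkcts ci \o s = s :> sing_simplex R _ 2).
    by apply/eqP/freeg_eqP => x; rewrite coeffZ !coeffU mul1r.
  exact/continuousEP.
have hI : 0 < 1 / 2 :> R by lra.
have h1 : 1 / 2 < 1 :> R by lra.
have h01 : 0 < (1 / 2 : R) < 1 by rewrite hI h1.
have hI01 : 0 <= (1 / 2 : R) <= 1 by rewrite !ltW.
have NS0 : NS (1 / 2) = 0.
  rewrite -(south_const W (lexx 0) (ltW hI) (ltW h1)); last first.
    by move=> x /andP[_ x1] /=; lra.
  by apply: (south_start W) => /=.
have NN1 : NN (1 / 2) = NN 1.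
  apply: (north_const W (ltW hI) (ltW h1) (lexx 1)).
  by move=> x /andP[x0 _] /=; lra.
rewrite -(north_end W) //=; rewrite -NN1.
have [b [cb bP bE]] := latitude_degree W hI01 h01.
have p2 : 2 * pi != 0 :> R by rewrite mulf_neq0 ?gt_eqF ?pi_gt0.
have cid : continuous (fun th : R => 2 * pi * th).
  by apply: ctsM; [exact: cts_cst|move=> x; exact: cvg_id].
have cb2 : continuous (fun th : R => 2 * pi * b th).
  by apply: ctsM => //; exact: cts_cst.
have := polar_increment cb2 cid bP (fun th _ => sph_polar th h01).
by rewrite -mulrBr bE NS0 subr0 mulr0 subr0 mulr1 => ->.
Qed.

Lemma many_fixed_card (g : sphere R -> sphere R) (m : nat) :
  many_fixed g setT m -> `I_m #<= [set p | g p = p].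
Proof.
move=> [s [us ms sP]]; rewrite lez_nat in ms.
have inj : {in `I_m &, injective (nth (sph 0 0) s)}.
  move=> i j; rewrite !inE /= => im jm /eqP.
  by rewrite nth_uniq ?(leq_trans im) ?(leq_trans jm) // => /eqP.
apply: card_le_trans (subset_card_le (A := nth (sph 0 0) s @` `I_m) _); last first.
  move=> _ [i im <-] /=; apply: (sP _ _).1.
  by apply: mem_nth; exact: leq_trans ms.
by rewrite (card_le_eqr (inj_card_eq inj)).
Qed.

End Assembly.

Theorem theorem1 (R : realType) (f : continuousType (sphere R) (sphere R))
    (f_C1 : C1_sphere f) (f_lat : preserves_latitudes f)
    (f_deg : global_degree R f 2) (n : nat) (n_ge1 : (1 <= n)%N) :
  `I_(2 ^ n) #<= [set p : sphere R | iter n f p = p].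
Proof.
have cg : continuous (iter n f).
  elim: n {n_ge1} => [|n IH]; first by move=> x; exact: cvg_id.
  by apply: (cts_comp IH); exact: cts_fun.
pose g := iter n f; pose phi t := height (g (sph 0 t)).
have phiE (th t : R) : height (g (sph th t)) = phi t.
  by apply: iter_height => //; rewrite !height_sph.
have cphi : continuous phi.
  apply: (cts_comp (cts_comp (@sph_continuous R 0) cg)).
  exact: sphere_coord_continuous.
have [NS [NN W]] := @winding_data_ex R (mkcts cg) phi (fun th t _ _ => phiE th t).
set c := class _ in W.
have cE : c = 2 * pi * (2 ^ n : nat)%:~R.
  rewrite /c (class_iter (n := n) f_deg (fund_cycle_boundary R)) // class_fund_cycle mulrC.
  by congr (_ * _); rewrite -natrX -pmulrn.
(* Where [phi] stays strictly between 0 and 1 both integers are constant, so the latitude at [s] has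
   the degree found at the reference height [h0]. *)
have local (s h0 : R) : 0 < s < 1 -> 0 < h0 < 1 -> 2 <= NN h0 - NS h0 ->
    (forall x, Num.min s h0 <= x <= Num.max s h0 -> 0 < phi x < 1) ->
  exists b : R -> R, [/\ continuous b,
      forall th, 0 <= th <= 1 ->
        polar (2 * pi * b th) (crd1 (g (sph th s))) (crd2 (g (sph th s))) &
      b 1 - b 0 = `|NN h0 - NS h0|%N%:R].
  move=> s01 h01 d2 pI; have [s0 s1] := andP s01; have [h0_gt0 h1] := andP h01.
  have sE : NN s = NN h0 /\ NS s = NS h0.
    have [sh|hs] := leP s h0.
      have pJ x : s <= x <= h0 -> 0 < phi x < 1.
        by move=> xI; apply: pI; rewrite (min_idPl sh) (max_idPr sh).
      split; [apply: (north_const W)|apply: (south_const W)] => //; try exact: ltW;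
        by move=> x /pJ/andP[].
    have pJ x : h0 <= x <= s -> 0 < phi x < 1.
      by move=> xI; apply: pI; rewrite (min_idPr (ltW hs)) (max_idPl (ltW hs)).
    split; apply/esym; [apply: (north_const W)|apply: (south_const W)] => //; try exact: ltW;
      by move=> x /pJ/andP[].
  have sI : 0 <= s <= 1 by rewrite !ltW.
  have [|b [cb bP bE]] := latitude_degree W sI.
    by apply: pI; rewrite ge_min le_max !lexx.
  exists b; split => //; rewrite bE sE.1 sE.2 pmulrn gez0_abs //.
  exact: le_trans d2.
have dge (h0 : R) : 2 <= NN h0 - NS h0 -> (2 <= `|NN h0 - NS h0|)%N.
  by move=> d2; rewrite -lez_nat gez0_abs //; exact: le_trans d2.
apply: many_fixed_card; apply: (@count_fixed _ _ phi c NS NN) => //.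
(* The height [h0] fixes the degree before the threshold [e] is obtained; [s] is then chosen at most
   [h0] and below [e]. *)
- move=> r p0 r0 r1 rP; pose h0 := r / 2.
  have h0I : 0 < h0 < r by rewrite /h0; apply/andP; split; lra.
  have [ph d2] := rP h0 h0I.
  have [e e0 eP] := pole_attracts (fun th t _ => phiE th t) cphi (or_introl (erefl 0)) p0
    (iter_differentiable n _ f_C1) (dge _ d2).
  pose s := Num.min h0 (e / 2).
  have [h0_gt0 h0r] := andP h0I.
  have s0 : 0 < s by rewrite lt_min h0_gt0 divr_gt0.
  have sh : s <= h0 by rewrite ge_min lexx.
  have se : s < e by rewrite /s gt_min; apply/orP; right; lra.
  have sr : 0 < s < r by rewrite s0 (le_lt_trans sh).
  have s01 : 0 < s < 1 by rewrite s0; lra.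
  exists s => //; have := eP s s01; rewrite !subr0 gtr0_norm // => /(_ se (rP s sr).1).
  have [||b bP] := local s h0 s01 _ d2.
  + by rewrite h0_gt0; lra.
  + rewrite (min_idPl sh) (max_idPr sh) => x /andP[x1 x2].
    by apply: (rP x _).1; apply/andP; split; lra.
  move=> /(_ (ex_intro _ b bP)); rewrite gtr0_norm //.
  by case/andP: (rP s sr).1.
- move=> r p1 r0 r1 rP; pose h0 := (r + 1) / 2.
  have h0I : r < h0 < 1 by rewrite /h0; apply/andP; split; lra.
  have [ph d2] := rP h0 h0I.
  have [e e0 eP] := pole_attracts (fun th t _ => phiE th t) cphi (or_intror (erefl 1)) p1
    (iter_differentiable n _ f_C1) (dge _ d2).
  pose s := Num.max h0 (1 - e / 2).
  have [h0_gt0 h0r] := andP h0I.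
  have s1 : s < 1 by rewrite gt_max h0r /=; lra.
  have sh : h0 <= s by rewrite le_max lexx.
  have se : 1 - s < e.
    have : 1 - e / 2 <= s by rewrite le_max lexx orbT.
    lra.
  have sr : r < s < 1 by rewrite s1 (lt_le_trans h0_gt0).
  have s01 : 0 < s < 1 by rewrite s1 andbT; lra.
  have sn : s - 1 < 0 by rewrite subr_lt0.
  exists s => //; have := eP s s01; rewrite ltr0_norm // opprB => /(_ se (rP s sr).1).
  have [||b bP] := local s h0 s01 _ d2.
  + by apply/andP; split; lra.
  + rewrite (min_idPr sh) (max_idPl sh) => x /andP[x1 x2].
    by apply: (rP x _).1; apply/andP; split; lra.
  move=> /(_ (ex_intro _ b bP)); rewrite ltr0_norm; last first.
    by rewrite subr_lt0; case/andP: (rP s sr).1.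
  lra.
Qed.
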